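(* Let $I:U\to\mathbb{R}$ be a smooth function whose domain $U\subset\mathbb{R}$ is open and connected, let $c_I$ be the conformal structure on $M_I$ induced by the generic $2$-plane field $D_I$, and let $\widetilde g_I$ be its Ricci-flat ambient metric $$\widetilde g_I = 2\rho\,dt^2+2t\,dt\,d\rho+t^2\left(g_I-\tfrac23\rho I\,dx^2\right)$$ on $\widetilde M_I=\mathbb{R}_+\times M_I\times\mathbb{R}$. Then $$\mathrm{Hol}(\nabla^{\mathcal T}_I)\cong \mathrm{Hol}(\widetilde g_I)\cong \mathrm{H}_5,$$ where $\nabla^{\mathcal T}_I$ is the (normal conformal) tractor connection of $c_I$ and $\mathrm{H}_5$ is the $5$-dimensional Heisenberg group.
   Context: Setting. For a smooth $I:U\to\mathbb{R}$ let $M_I=\{(x,y,p,q,z)\in\mathbb{R}^5: x\in U\}$, identify $I$ with its pullback $I(x)$ to $M_I$, and put $$F_I=-\tfrac12\left[q^2+\tfrac{10}{3}I p^2+(1+I^2-I'')y^2\right].$$ Define the coframe on $M_I$ $$\omega^1=dy-p\,dx,\quad \omega^2=dz-F_I\,dx-(\partial_qF_I)(dp-q\,dx),\quad \omega^3=dp-q\,dx,\quad \omega^4=dq,\quad \omega^5=dx .$$ $D_I=\ker\{\omega^1,\omega^2,\omega^3\}$ is a $2$-plane field on $M_I$ that is generic, i.e. $[D_I,[D_I,D_I]]=TM_I$. The canonical (Nurowski) conformal structure of signature $(2,3)$ that $D_I$ induces is $c_I=[g_I]$, where $$g_I=-3I(\omega^1)^2+3\,\omega^1\omega^4-10Ip\,\omega^1\omega^5-3\,\omega^2\omega^5-2(\omega^3)^2,$$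 and $\omega^i\omega^j=\tfrac12(\omega^i\otimes\omega^j+\omega^j\otimes\omega^i)$. On $\widetilde M_I$, $t$ and $\rho$ are the coordinates on the factors $\mathbb{R}_+$ and $\mathbb{R}$, and pullbacks along $\widetilde M_I\to M_I$ are suppressed. Ambient metric. The metric bundle $\mathcal G\to M$ of a conformal manifold $(M,c)$ is the ray bundle of the inner products $g_u$, $g\in c$, $u\in M$. A choice $g\in c$ identifies $t^2g_u$ with $(t,u)\in\mathbb{R}_+\times M$; the tautological degenerate tensor is $\mathbf g_0=t^2g$; $\mathcal G$ is identified with $\{\rho=0\}\subset\mathcal G\times\mathbb{R}$; the dilations are $\delta_s:(t,u,\rho)\mapsto(st,u,\rho)$. A Ricci-flat ambient metric for $c$ is a Ricci-flat metric $\widetilde g$ on a dilation-invariant open neighborhood of $\mathcal G$ with $\widetilde g|_{T\mathcal G}=\mathbf g_0$, $\delta_s^*\widetilde g=s^2\widetilde g$, and such that every curve $s\mapsto\delta_s(p)$ is a geodesic. Tractor connection. The fiber over $u$ of the standard tractor bundle $\mathcal T\to M$ (rank $\dim M+2$) is the space of vector fields $\xi$ of $\widetilde M$ along $\mathcal G_u$ with $T\delta_s\cdot\xi=s\,\xi$ for all $s>0$ (here $(T\delta_s\cdot\xi)$ is compared with $\xi$ at the image point). For $X\in\Gamma(\mathcal T)$ and $\xi\in\Gamma(TM)$, $\nabla^{\mathcal T}_\xi X=\widetilde\nabla_{\bar\xi}X$, where $\widetilde\nabla$ is the Levi-Civita connection of $\widetilde g$ and $\bar\xi$ is any dilation-invariant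 lift of $\xi$ to $\mathcal G$. This agrees with the usual normal conformal tractor connection. $\mathrm{Hol}(\nabla)$ is the holonomy group of a connection (group of parallel transports around loops at a base point, defined up to conjugacy), and $\mathrm{Hol}(\widetilde g)$ is that of the Levi-Civita connection. $\mathrm H_5$ is the simply connected Lie group with Lie algebra $\mathfrak h_5$ having basis $a_1,a_2,b_1,b_2,c$ and only nonzero brackets $[a_1,b_1]=[a_2,b_2]=c$. *)

(* Defs.v *)
From mathcomp Require Import all_boot all_order all_algebra.
From mathcomp Require Import all_classical all_reals all_analysis.
From mathcomp Require Import ring.
Export numFieldNormedType.Exports.

Set Implicit Arguments.
Unset Strict Implicit.
Unset Printing Implicit Defensive.

Import Order.TTheory GRing.Theory Num.Theory.
Local Open Scope classical_set_scope.
Local Open Scope ring_scope.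

Section Smoothness.
Context {R : realType}.

Definition unit_vec n (i : 'I_n) : 'rV[R]_n := delta_mx 0 i.

Definition smooth_on (U : set R) (f : R -> R) : Prop :=
  forall (k : nat) (x : R), U x -> derivable (f^`(k))%classic x 1.

Fixpoint Ck n (k : nat) (f : 'rV[R]_n -> R) : Prop :=
  continuous f /\
  if k is k'.+1 then
    forall i, (forall x, derivable f x (unit_vec i)) /\
              Ck k' (fun x => 'D_(unit_vec i) f x)
  else True.

Definition smooth n (f : 'rV[R]_n -> R) : Prop := forall k, Ck k f.

(* A smooth arc is parametrized by [0, 1].  Being smooth on a closed interval
   means having a smooth extension to R; only the restriction of [g] to [0, 1]
   is used anywhere, and only that restriction has to stay in [D]. *)
Definition smooth_arc n (D : set 'rV[R]_n) (g : R -> 'rV[R]_n) : Prop :=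
  (forall i, smooth_on setT (fun s => g s 0 i)) /\
  (forall s : R, 0 <= s <= 1 -> D (g s)).

End Smoothness.

Section Holonomy.
Context {R : realType}.

(* A linear connection on a vector bundle of rank [m] over an open subset of
   R^n, in a global frame (e_k):  nabla_{d/du_i} e_k = \sum_j A u i j k e_j.
   The fibers are column vectors in this frame. *)
Definition connection n m := 'rV[R]_n -> 'I_n -> 'M[R]_m.

(* [B] is the parallel transport along the arc [g]: the columns of [P] are the
   parallel sections along [g] that start at the frame vectors. *)
Definition arc_transport n m (A : connection n m) (g : R -> 'rV[R]_n)
    (B : 'M[R]_m) : Prop :=
  exists P : R -> 'M[R]_m,
    [/\ P 0 = 1%:M,
        P 1 = B &
        forall s : R, 0 <= s <= 1 -> forall j k,
          is_derive s (1 : R) (fun r => P r j k)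
            (- \sum_(i < n) ((fun r => g r 0 i)^`())%classic s *
                 (\sum_(l < m) A (g s) i j l * P s l k))].

(* Parallel transport from [p] along piecewise smooth paths in [D], i.e.,
   finite concatenations of smooth arcs. *)
Inductive transport n m (D : set 'rV[R]_n) (A : connection n m)
    (p : 'rV[R]_n) : 'rV[R]_n -> 'M[R]_m -> Prop :=
| transport_nil : D p -> transport D A p p 1%:M
| transport_arc (g : R -> 'rV[R]_n) (B C : 'M[R]_m) :
    transport D A p (g 0) B -> smooth_arc D g -> arc_transport A g C ->
    transport D A p (g 1) (C *m B).

Definition holonomy n m (D : set 'rV[R]_n) (A : connection n m)
    (p : 'rV[R]_n) : set 'M[R]_m :=
  [set B | transport D A p p B].

End Holonomy.

Section Heisenberg.
Context {R : realType}.
Implicit Types x y z : 'rV[R]_5.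

(* h_5 is R^5 with basis (a_1, a_2, b_1, b_2, c) = (e_0, e_1, e_2, e_3, e_4). *)
Definition h5_bracket x y : 'rV[R]_5 :=
  (x 0 0 * y 0 2 - x 0 2 * y 0 0 + (x 0 1 * y 0 3 - x 0 3 * y 0 1))
    *: unit_vec 4.

(* H_5 is realized on R^5, which is simply connected, in exponential
   coordinates: by the Baker-Campbell-Hausdorff formula (h_5 is 2-step
   nilpotent), exp x * exp y = exp (x + y + [x, y] / 2).  The identity is 0 and
   the inverse of x is - x. *)
Definition H5_mul x y : 'rV[R]_5 := x + y + 2^-1 *: h5_bracket x y.

Lemma H5_mulA : associative H5_mul.
Proof.
move=> x y z; apply/rowP => i; rewrite /H5_mul /h5_bracket /unit_vec !mxE /=.
by case: (i == 4); field.
Qed.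

Lemma H5_mul0x : left_id 0 H5_mul.
Proof.
move=> x; apply/rowP => i; rewrite /H5_mul /h5_bracket /unit_vec !mxE /=.
by field.
Qed.

Lemma H5_mulNx x : H5_mul (- x) x = 0.
Proof.
apply/rowP => i; rewrite /H5_mul /h5_bracket /unit_vec !mxE /=.
by field.
Qed.

Lemma H5_commutator x y :
  H5_mul (H5_mul x y) (H5_mul (- x) (- y)) = h5_bracket x y.
Proof.
apply/rowP => i; rewrite /H5_mul /h5_bracket /unit_vec !mxE /=.
by case: (i == 4); field.
Qed.

(* An isomorphism of Lie groups from H_5 onto a subgroup [G] of GL_m(R), the
   latter with its structure of immersed Lie subgroup: a group isomorphism onto
   [G] that is a smooth immersion into the space of matrices. *)
Definition isomorphic_H5 m (G : set 'M[R]_m) : Prop :=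
  exists phi : 'rV[R]_5 -> 'M[R]_m,
    [/\ (forall x y, phi (H5_mul x y) = phi x *m phi y),
        injective phi,
        range phi = G,
        (forall i j, smooth (fun x => phi x i j)) &
        (forall x v, 'D_v phi x = 0 -> v = 0)].

End Heisenberg.

Section LeviCivita.
Context {R : realType} {n : nat}.

(* A symmetric 2-tensor field on an open subset of R^n: [g p v w] = g_p(v, w). *)
Definition tensor2 := 'rV[R]_n -> 'rV[R]_n -> 'rV[R]_n -> R.

Implicit Type g : tensor2.

Definition gram g (p : 'rV[R]_n) : 'M[R]_n :=
  \matrix_(i, j) g p (unit_vec i) (unit_vec j).

Definition christoffel g (p : 'rV[R]_n) (k i j : 'I_n) : R :=
  2^-1 * \sum_(l < n) invmx (gram g p) k l *
    ('D_(unit_vec i) (fun q => gram g q j l) p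
     + 'D_(unit_vec j) (fun q => gram g q i l) p
     - 'D_(unit_vec l) (fun q => gram g q i j) p).

(* The covariant derivative at [p] of the vector field [Y] in the direction
   [v], for the Levi-Civita connection of [g]. *)
Definition covariant g (v : 'rV[R]_n) (Y : 'rV[R]_n -> 'rV[R]_n)
    (p : 'rV[R]_n) : 'rV[R]_n :=
  'D_v Y p
  + \row_k \sum_(i < n) \sum_(j < n) christoffel g p k i j * v 0 i * Y p 0 j.

Definition levi_civita g : connection n n :=
  fun p i => \matrix_(j, k) covariant g (unit_vec i) (cst (unit_vec k)) p 0 j.

End LeviCivita.

Arguments tensor2 : clear implicits.

Section Tractor.
Context {R : realType}.

(* Coordinates on R_+ x M x R, with M open in R^5:
   t has index [ord0], rho has index [ord_max], and the i-th coordinate of M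
   has index [mid i]. *)
Definition mid (i : 'I_5) : 'I_7 := lift ord0 (widen_ord (leqnSn 5) i).

Definition base (P : 'rV[R]_7) : 'rV[R]_5 := \row_i P 0 (mid i).

(* The point of the metric bundle G = {rho = 0} over [u] at height [t]. *)
Definition ray (t : R) (u : 'rV[R]_5) : 'rV[R]_7 :=
  t *: unit_vec ord0 + \sum_(i < 5) u 0 i *: unit_vec (mid i).

(* The dilation (t, u, rho) |-> (s t, u, rho); it is linear, so that the same
   formula gives its tangent map. *)
Definition dilation (s : R) (V : 'rV[R]_7) : 'rV[R]_7 :=
  \row_i (if i == ord0 then s * V 0 i else V 0 i).

(* The fiber of the standard tractor bundle at any [u]: vector fields [xi]
   along the ray t |-> ray t u, with T delta_s . xi = s xi. *)
Definition tractor (xi : R -> 'rV[R]_7) : Prop :=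
  forall s t : R, 0 < s -> 0 < t -> dilation s (xi t) = s *: xi (s * t).

(* A global frame of the standard tractor bundle; it corresponds to the
   canonical basis of R^7 under the evaluation of tractors at t = 1. *)
Definition tractor_frame (k : 'I_7) (t : R) : 'rV[R]_7 :=
  t^-1 *: dilation t (unit_vec k).

Lemma tractor_frame1 k : tractor_frame k 1 = unit_vec k.
Proof.
by apply/rowP => i; rewrite !mxE invr1 mul1r mul1r; case: ifP.
Qed.

Lemma tractor_frame_tractor k : tractor (tractor_frame k).
Proof.
move=> s t s0 t0; apply/rowP => i; rewrite !mxE.
have [sn tn] : s != 0 /\ t != 0 by rewrite !gt_eqF.
by set b := _%:R; case: (i == ord0); field; rewrite sn tn.
Qed.

Lemma tractorE xi (t : R) : tractor xi -> 0 < t ->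
  xi t = \sum_k xi 1 0 k *: tractor_frame k t.
Proof.
move=> xiT t0; have := xiT t 1 t0 ltr01; rewrite mulr1 => xit.
have tn : t != 0 by rewrite gt_eqF.
rewrite -[LHS](scalerK tn) -xit; apply/rowP => i; rewrite !mxE summxE.
rewrite (bigD1 i) //= big1 ?addr0 => [|j ji]; rewrite !mxE !eqxx /=.
  by case: (i == ord0); field.
by rewrite [i == j]eq_sym (negbTE ji) !mulr0 if_same !mulr0.
Qed.

(* The tractor connection induced by an ambient metric [gt], in the frame
   [tractor_frame]: nabla_{d/du_i} E_k is the ambient covariant derivative of
   E_k along G in the direction of the dilation-invariant lift of d/du_i with
   no d/dt-component, and its coefficients in the frame are read off at t = 1,
   where E_j = e_j.  (Other invariant lifts differ by a multiple of t d/dt,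
   along which tractors have zero ambient covariant derivative.)  E_k does not
   depend on u and rho. *)
Definition tractor_connection (gt : tensor2 R 7) : connection 5 7 :=
  fun u i => \matrix_(j, k)
    covariant gt (unit_vec (mid i)) (fun P => tractor_frame k (P 0 ord0))
      (ray 1 u) 0 j.

End Tractor.

Section Metrics.
Context {R : realType}.
Variables (U : set R) (I : R -> R).
Implicit Types (u v w : 'rV[R]_5) (P V W : 'rV[R]_7).

(* The coordinates (x, y, p, q, z) have indices 0, 1, 2, 3, 4. *)
Definition M_I : set 'rV[R]_5 := [set u : 'rV[R]_5 | U (u 0 0)].

Definition F_I u : R :=
  - 2^-1 * (u 0 3 ^+ 2 + 10 / 3 * I (u 0 0) * u 0 2 ^+ 2
            + (1 + I (u 0 0) ^+ 2 - (I^`(2))%classic (u 0 0)) * u 0 1 ^+ 2).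

Definition omega1 u v : R := v 0 1 - u 0 2 * v 0 0.
Definition omega2 u v : R :=
  v 0 4 - F_I u * v 0 0 - 'D_(unit_vec 3) F_I u * (v 0 2 - u 0 3 * v 0 0).
Definition omega3 u v : R := v 0 2 - u 0 3 * v 0 0.
Definition omega4 u v : R := v 0 3.
Definition omega5 u v : R := v 0 0.

Definition symprod n (a b : 'rV[R]_n -> R) (v w : 'rV[R]_n) : R :=
  2^-1 * (a v * b w + b v * a w).

Definition g_I : tensor2 R 5 := fun u v w =>
  - 3 * I (u 0 0) * symprod (omega1 u) (omega1 u) v w
  + 3 * symprod (omega1 u) (omega4 u) v w
  - 10 * I (u 0 0) * u 0 2 * symprod (omega1 u) (omega5 u) v w
  - 3 * symprod (omega2 u) (omega5 u) v w
  - 2 * symprod (omega3 u) (omega3 u) v w.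

Definition Mt_I : set 'rV[R]_7 := [set P : 'rV[R]_7 | 0 < P 0 ord0 /\ M_I (base P)].

Definition dt V : R := V 0 ord0.
Definition drho V : R := V 0 ord_max.

(* The Ricci-flat ambient metric of the conformal structure [g_I] that the
   2-plane field ker {omega1, omega2, omega3} induces. *)
Definition gt_I : tensor2 R 7 := fun P V W =>
  let t := P 0 ord0 in let rho := P 0 ord_max in let u := base P in
  2 * rho * symprod dt dt V W
  + 2 * t * symprod dt drho V W
  + t ^+ 2 * (g_I u (base V) (base W)
              - 2 / 3 * rho * I (u 0 0)
                * symprod (omega5 u) (omega5 u) (base V) (base W)).

End Metrics.

(* Main.v *)
Require Import Defs.
From mathcomp Require Import all_boot all_order all_algebra.
From mathcomp Require Import all_classical all_reals all_analysis.
From mathcomp Require Import ring lra.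

Set Implicit Arguments.
Unset Strict Implicit.
Unset Printing Implicit Defensive.

Import Order.TTheory GRing.Theory Num.Theory.
Import numFieldNormedType.Exports.

Local Open Scope classical_set_scope.
Local Open Scope ring_scope.

(** The ambient metric is a plane wave, and a coframe shows it.  Let s1, s2 be
    two solutions of s'' = I s / 3 with Wronskian s1 s2' - s1' s2 = 1; they
    exist on the whole interval U because the equation is linear.  With
    D = 3 q y - 3 I y^2 - 2 p^2, r = rho - D / 2 and
    L = - p q - 3 z - 2 I y p + (3 / 2) I' y^2, put

      a   = t s1,    b = t s2,
      mij = t (q - I y) si sj - 2 t p (si sj)' + 6 t y si' sj',
      v1  = 2 t r s2' - t L s2,    v2 = - 2 t r s1' + t L s1.

    Then the ambient metric is
    da dv1 + db dv2 + (dm11 dm22 - dm12^2) / 2 - (3 / 2) t^2 y^2 dx^2.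
    Since t^2 dx = a db - b da, the last term is absorbed by replacing dv1 and
    dv2 by dv1 + (3 / 2) y^2 b dx and dv2 - (3 / 2) y^2 a dx.  In the resulting
    coframe e the metric has constant coefficients eta, and Cartan's first
    structure equation de + theta /\ e = 0 holds for a connection form
    theta = N dx whose matrix N runs through a copy of h_5 inside so(eta): its
    components modulo the centre are y s1^3, y s1^2 s2, y s1 s2^2, y s2^3, and
    its central component is proportional to y^2 (gt_I_formE, eta_coframe,
    torsion_free).  Koszul's formula in a moving frame
    (levi_civita_frame) identifies this with the Levi-Civita connection.

    So, in this frame, parallel transport along an arc solves Q' = - x' N Q with
    a nilpotent N, and Q = exp (xi) where xi is obtained by quadratures
    (arc_xi).  Hence every holonomy element is conjugate, by the frame at the
    base point, to the exponential of an element of h_5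
    (transport_conj_exp).

    Conversely, a loop that moves y by b, then x from x0 to x1, then y back,
    then x back, realizes an element whose components modulo the centre are
    - b times the integrals over [x0, x1] of the four cubic monomials in s1 and
    s2, up to constants.  A cubic form in (s1, s2) that vanishes identically is
    zero, so these vectors span R^4, and the realized elements project onto
    H_5 modulo its centre (realized_mod_center).  Commutators of realized
    elements fill the centre, so everything is realized (realized_all).

    The tractor connection is the pullback of the Levi-Civita connection along
    u |-> (1, u, 0) (tractor_levi_civita).  Both cases are therefore instances
    of one argument, for a connection on R^n pulled back along an affine map
    that reaches the x- and y-directions (holonomy_H5). *)

(** * Differential equations on an interval *)

Section OneVariable.
Context {R : realType}.
Implicit Types (U : set R) (f F : R -> R).

Lemma is_derive_continuous f x d : is_derive x (1 : R) f d -> {for x, continuous f}.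
Proof.
by move=> [+ _] => /derivable1_diffP; exact: differentiable_continuous.
Qed.

Lemma for_continuousM (f g : R -> R) x : {for x, continuous f} -> {for x, continuous g} ->
  {for x, continuous (fun r => f r * g r)}.
Proof. exact: continuousM. Qed.

Lemma for_continuousD (f g : R -> R) x : {for x, continuous f} -> {for x, continuous g} ->
  {for x, continuous (fun r => f r + g r)}.
Proof. exact: continuousD. Qed.

Lemma for_continuousX (f : R -> R) n x : {for x, continuous f} ->
  {for x, continuous (fun r => f r ^+ n)}.
Proof.
move=> cf; apply: (@continuous_comp _ _ _ f (fun y => y ^+ n)) => //.
exact: exprn_continuous.
Qed.

Lemma for_continuous_cst (c x : R) : {for x, continuous (fun _ : R => c)}.
Proof. exact: cvg_cst. Qed.

Lemma open_interval_around U (a b : R) : open U -> is_interval U -> U a -> U b ->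
  exists c d, [/\ c < a, c < b, a < d, b < d & `[c, d]%classic `<=` U].
Proof.
move=> oU iU Ua Ub.
have H (x : R) : U x -> exists2 e, 0 < e & U (x - e) /\ U (x + e).
  move=> Ux; have /nbhs_ballP[e /= e0 eU] := oU _ Ux.
  have e20 : 0 < e / 2 by rewrite divr_gt0.
  by exists (e / 2) => //; split; apply: eU; rewrite /ball /= ltr_norml; lra.
have [e e0 [Uae Uae']] := H _ Ua; have [h h0 [Ubh Ubh']] := H _ Ub.
exists (Num.min (a - e) (b - h)), (Num.max (a + e) (b + h)).
split; rewrite ?gt_min ?lt_max ?ltrDl ?gtrDl ?oppr_lt0 ?e0 ?h0 ?orbT//.
move=> x /=; rewrite in_itv /= => xcd.
apply: (iU _ _ _ _ x xcd); first by rewrite /Num.min; case: ifP.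
by rewrite /Num.max; case: ifP.
Qed.

(** The interval need not be compact and the base point need not be an endpoint,
    so the primitive is the signed integral from a fixed x0.  Around a given x1
    it differs by a constant from the integral from a point c to the left of
    both, to which the fundamental theorem of calculus applies. *)
Lemma antiderivative U f : open U -> is_interval U ->
  (forall x, U x -> {for x, continuous f}) ->
  exists F, forall x, U x -> is_derive x (1 : R) F (f x).
Proof.
move=> oU iU fc; have [[x0 Ux0]|U0] := pselect (exists x, U x); last first.
  by exists f => x Ux; case: U0; exists x.
pose S a x := (\int[@lebesgue_measure R]_(t in `[a, x]) f t)%R.
exists (fun x => if x0 <= x then S x0 x else - S x x0) => x1 Ux1.
have [c [d [cx0 cx1 x0d x1d cdU]]] := open_interval_around oU iU Ux0 Ux1.
have cd := lt_trans cx0 x0d.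
have cf : {within `[c, d], continuous f}.
  by apply: continuous_in_subspaceT => x /set_mem /cdU /fc.
have intf : lebesgue_measure.-integrable `[c, d] (EFin \o f).
  by apply: continuous_compact_integrable => //; exact: segment_compact.
have [dS eS] := continuous_FTC1_closed x1d intf cx1 (fc _ Ux1).
have SB a b : c < a -> a <= b -> b < d -> S c b - S c a = S a b.
  move=> ca ab bd; have sub e : (BRight e <= BRight d)%O ->
    lebesgue_measure.-integrable [set` Interval (BLeft c) (BRight e)] (EFin \o f).
    by move=> ed; apply: integrableS intf => //; exact: subset_itvl.
  have ib : lebesgue_measure.-integrable [set` Interval (BLeft c) (BRight b)]
    (EFin \o f) by apply: sub; rewrite bnd_simp ltW.
  rewrite /S (Rintegral_itvB ib) ?bnd_simp ?(ltW ca)//.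
  apply: Rintegral_itv_obnd_cbnd.
  apply: integrableS intf => //; apply: subset_itv; rewrite bnd_simp; exact/ltW.
apply: (@near_eq_is_derive _ _ _ (fun x => S c x - S c x0)).
  have cx : \forall x \near x1, c < x by exact: lt_nbhsr.
  have xd : \forall x \near x1, x < d by exact: lt_nbhsl.
  near=> x; have cx' : c < x by near: x.
  have xd' : x < d by near: x.
  case: leP => [x0x|/ltW xx0]; first by rewrite (SB x0 x).
  by rewrite -(SB x x0)// opprB.
rewrite -eS derive1E -[X in is_derive _ _ _ X]subr0.
by apply: is_deriveB; exact: derivableP.
Unshelve. all: by end_near. Qed.
Lemma MVT_interval U f df x y : is_interval U ->
  (forall z, U z -> is_derive z (1 : R) f (df z)) -> U x -> U y ->
  exists c, [/\ U c, 0 <= (c - x) * (y - x) & f y - f x = df c * (y - x)].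
Proof.
move=> iU dfU.
have H a b : U a -> U b -> a <= b ->
    exists c, [/\ U c, a <= c <= b & f b - f a = df c * (b - a)].
  move=> Ua Ub ab.
  have sU z : z \in `[a, b] -> U z by rewrite in_itv /= => ?; exact: (iU _ _ Ua Ub).
  have [c cab cE] : exists2 c, c \in `[a, b] & f b - f a = df c * (b - a).
    apply: MVT_segment => // [z zab|]; first exact/dfU/sU/subset_itv_oo_cc.
    apply: continuous_in_subspaceT => z /set_mem zab.
    by apply: is_derive_continuous (dfU _ _); exact: sU.
  by exists c; split => //; exact: sU.
move=> Ux Uy; case: (leP x y) => [xy|/ltW yx].
  have [c [Uc /andP[xc cy] cE]] := H _ _ Ux Uy xy.
  by exists c; split => //; apply: mulr_ge0; rewrite subr_ge0.
have [c [Uc /andP[yc cx] cE]] := H _ _ Uy Ux yx.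
exists c; split => //; last by rewrite -opprB cE -mulrN opprB.
by rewrite mulr_le0// subr_le0.
Qed.

(** This is the contraction estimate behind the existence of solutions of linear
    equations.  The weight exp (2 |B|), with B' = m a majorant of the
    coefficients, makes integration contract by 1/2 on the whole of U,
    compact or not. *)
Lemma derivative_comparison U x0 (m B D d : R -> R) (K : R) :
  is_interval U -> U x0 ->
  (forall x, U x -> is_derive x (1 : R) B (m x)) ->
  (forall x, U x -> is_derive x (1 : R) D (d x)) ->
  B x0 = 0 -> D x0 = 0 -> 0 <= K -> (forall x, U x -> 0 <= m x) ->
  (forall x, U x -> `|d x| <= K * m x * expR (2 * `|B x|)) ->
  forall x, U x -> `|D x| <= K / 2 * expR (2 * `|B x|).
Proof.
move=> iU Ux0 dB dD B0 D0 K0 m0 dK x Ux.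
(* s is the side of x0 on which x lies; on that side |B| = s B. *)
pose s : R := if x0 <= x then 1 else -1.
have s2 : s * s = 1 by rewrite /s; case: ifP; rewrite ?mulr1 ?mulN1r ?opprK.
have sB c : U c -> 0 <= (c - x0) * s -> `|B c| = s * B c.
  move=> Uc sc; have [e [Ue _]] := MVT_interval iU dB Ux0 Uc.
  rewrite B0 subr0 => ->.
  have : 0 <= s * (m e * (c - x0)) by rewrite mulrC -mulrA mulr_ge0 ?m0.
  by move/ger0_norm => <-; rewrite [RHS]normrM (_ : `|s| = 1) ?mul1r// /s; case: ifP;
      rewrite ?normrN normr1.
have xs : 0 <= (x - x0) * s.
  by rewrite /s; case: (leP x0 x) => [|/ltW] ?; lra.
(* For each sign e, the majorant plus e D is monotone away from x0. *)
have H (e : R) : e * e = 1 -> 0 <= K / 2 * expR (2 * (s * B x)) + e * D x.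
  move=> e2.
  pose h z := K / 2 * expR (2 * (s * B z)) + e * D z.
  have dh z : U z -> is_derive z (1 : R) h (s * (K * m z * expR (2 * (s * B z))) + e * d z).
    move=> Uz; have := dB _ Uz; have := dD _ Uz => ? ?.
    rewrite /h.
    have -> : (fun z => K / 2 * expR (2 * (s * B z)) + e * D z) =
       (K / 2) *: (expR \o ((2 * s) *: B)) + e *: D.
      by apply/funext => t; rewrite !fctE /= mulrA.
    have dexp := is_derive1_comp (is_derive_expR _) (is_deriveZ (2 * s) (dB _ Uz)).
    have dh := is_deriveD (is_deriveZ (K / 2) dexp) (is_deriveZ e (dD _ Uz)).
    apply: (is_derive_eq dh).
    rewrite [X in expR X](_ : _ = 2 * (s * B z)); last by rewrite mulrA.
    by rewrite /GRing.scale /=; field.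
  have [c [Uc c0 cE]] := MVT_interval iU dh Ux0 Ux.
  have : 0 <= h x - h x0.
    rewrite cE.
    have [xx0|xx0] := eqVneq x x0; first by rewrite xx0 subrr mulr0.
    have sc : 0 <= (c - x0) * s.
      have := mulr_ge0 c0 xs; rewrite -mulrA (mulrA (x - x0)) -expr2 (mulrC _ s) mulrA.
      by rewrite pmulr_lge0// exprn_even_gt0 ?subr_eq0.
    have ds : `|e * d c * s| <= K * m c * expR (2 * (s * B c)).
      have := dK _ Uc; rewrite sB// !normrM.
      have -> : `|s| = 1 by rewrite /s; case: ifP; rewrite ?normrN normr1.
      have -> : `|e| = 1 by apply/eqP; rewrite -sqrp_eq1// -normrX expr2 e2 normr1.
      by rewrite mul1r mulr1.
    have -> : (s * (K * m c * expR (2 * (s * B c))) + e * d c) * (x - x0) =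
       (K * m c * expR (2 * (s * B c)) + e * d c * s) * ((x - x0) * s).
      transitivity ((s * (K * m c * expR (2 * (s * B c))) + (s * s) * (e * d c)) * (x - x0));
          last by ring.
      by rewrite s2 mul1r.
    apply: mulr_ge0 => //; rewrite addrC -lerBlDr sub0r.
    by move: ds; rewrite ler_norml => /andP[].
  rewrite /h B0 D0 !mulr0 expR0 mulr1 addr0 subr_ge0; apply: le_trans.
  by rewrite divr_ge0.
rewrite sB// ler_norml.
have := H 1 (mulr1 _); have := H (-1); rewrite mulN1r opprK => /(_ erefl).
by rewrite !mulN1r !mul1r => ? ?; apply/andP; split; lra.
Qed.

Lemma geometric_bound_eq0 (a b : R) : (forall n, `|a| <= b / 2 ^+ n) -> a = 0.
Proof.
move=> H; apply/eqP; rewrite -normr_eq0 eq_le normr_ge0 andbT.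
have /cvg_lim <- // : (b / 2 ^+ n @[n --> \oo] --> 0)%classic.
  under eq_fun do rewrite -exprVn.
  by apply: cvg_geometric; rewrite ger0_norm ?invr_ge0// invf_lt1 ?ltr1n.
apply: limr_ge; last by exists 0%N.
apply/cvg_ex; exists 0; under eq_fun do rewrite -exprVn.
by apply: cvg_geometric; rewrite ger0_norm ?invr_ge0// invf_lt1 ?ltr1n.
Qed.

Lemma geometric_limit (u : nat -> R) (K : R) :
  (forall n, `|u n.+1 - u n| <= K / 2 ^+ n) ->
  exists l, forall n, `|l - u n| <= 2 * K / 2 ^+ n.
Proof.
move=> H.
have K0 : 0 <= K by have := H 0%N; rewrite expr0 divr1; exact: le_trans.
have H2 n k : `|u (n + k)%N - u n| <= 2 * K / 2 ^+ n - 2 * K / 2 ^+ (n + k).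
  elim: k => [|k IH]; first by rewrite addn0 !subrr normr0.
  rewrite addnS -(subrKA (u (n + k)%N)).
  apply: le_trans (ler_normD _ _) _; apply: le_trans (lerD (H _) IH) _.
  rewrite exprS invfM (_ : 2 * K * (2^-1 * _) = K / 2 ^+ (n + k)).
    by rewrite le_eqVlt; apply/orP; left; apply/eqP; ring.
  by field; rewrite expf_neq0.
have H3 n k : `|u (n + k)%N - u n| <= 2 * K / 2 ^+ n.
  apply: le_trans (H2 n k) _.
  by rewrite gerBl divr_ge0 ?mulr_ge0 ?exprn_ge0.
have cvg0 : (2 * K / 2 ^+ n @[n --> \oo] --> 0)%classic.
  under eq_fun do rewrite -exprVn.
  by apply: cvg_geometric; rewrite ger0_norm ?invr_ge0// invf_lt1 ?ltr1n.
have cu : cvgn u.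
  apply/cauchy_cvgP/cauchy_exP => e e0.
  have /cvgrPdist_lt/(_ _ e0) [N _ /(_ N (leqnn _))] := cvg0.
  rewrite sub0r normrN ger0_norm ?divr_ge0 ?mulr_ge0 ?exprn_ge0// => Ne.
  exists (u N); exists N => // n /= Nn.
  by rewrite /ball /= distrC -(subnKC Nn); apply: le_lt_trans (H3 _ _) Ne.
exists (limn u) => n; apply/ler_addgt0Pl => e e0.
have /cvgrPdist_lt/(_ _ e0) [N _ /(_ (n + N)%N (leq_addl _ _))] := cu.
move=> /ltW Ne; rewrite -(subrKA (u (n + N)%N)).
by apply: le_trans (ler_normD _ _) _; exact: lerD.
Qed.

(** Picard iteration.  The second-order equation is taken as a first-order system
    whose two components are indexed by booleans and exchanged by negation;
    both components then satisfy literally the same estimates. *)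
Lemma linear_system_solution U x0 (c : bool -> R -> R) (a : bool -> R) :
  open U -> is_interval U -> U x0 ->
  (forall i x, U x -> {for x, continuous (c i)}) ->
  exists Y : bool -> R -> R, (forall i, Y i x0 = a i) /\
    forall i x, U x -> is_derive x (1 : R) (Y i) (c i x * Y (~~ i) x).
Proof.
move=> oU iU Ux0 cc.
have [J JP] : {J : (R -> R) -> R -> R & forall f, (forall x, U x -> {for x, continuous f}) ->
    J f x0 = 0 /\ forall x, U x -> is_derive x (1 : R) (J f) (f x)}.
  apply: (@choice _ _ (fun f F => (forall x, U x -> {for x, continuous f}) ->
    F x0 = 0 /\ forall x, U x -> is_derive x (1 : R) F (f x))) => f.
  have [fc|] := pselect (forall x, U x -> {for x, continuous f}); last by exists f.
  have [F dF] := antiderivative oU iU fc.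
  exists (fun x => F x - F x0) => _; rewrite subrr; split=> // x Ux.
  rewrite -[X in is_derive _ _ _ X]subr0.
  by have := dF _ Ux => ?; apply: is_deriveB.
pose m x := 1 + `|c true x| + `|c false x|.
have mc x : U x -> {for x, continuous m}.
  move=> Ux; apply: cvgD; first apply: cvgD; first exact: cvg_cst.
    by apply: cvg_norm; exact: cc.
  by apply: cvg_norm; exact: cc.
have m_ge1 x : 1 <= m x by rewrite /m -addrA lerDl addr_ge0.
have m_ge0 x : 0 <= m x by exact: le_trans (m_ge1 x).
have cm i x : `|c i x| <= m x by case: i; rewrite /m; have := normr_ge0 (c true x);
    have := normr_ge0 (c false x); lra.
have [B0 dB] := JP _ mc; set B := J m in B0 dB.
pose E x := expR (2 * `|B x|).
have E_ge1 x : 1 <= E x by rewrite /E -expR0 ler_expR mulr_ge0.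
have E_gt0 x : 0 < E x by exact: lt_le_trans (E_ge1 x).
have Ec x : U x -> {for x, continuous E}.
  move=> Ux; apply: (@continuous_comp _ _ _ (fun x => 2 * `|B x|) expR).
    apply: cvgM; first exact: cvg_cst.
    by apply: cvg_norm; exact: is_derive_continuous (dB _ Ux).
  exact: continuous_expR.
pose next (Y : bool -> R -> R) i x := a i + J (c i * Y (~~ i)) x.
have nextP Y : (forall i x, U x -> {for x, continuous (Y i)}) -> forall i, next Y i x0 = a i /\
    forall x, U x -> is_derive x (1 : R) (next Y i) (c i x * Y (~~ i) x).
  move=> Yc i; have /JP[J0 dJ] : forall x, U x -> {for x, continuous (c i * Y (~~ i))}.
    by move=> x Ux; apply: cvgM; [exact: cc|exact: Yc].
  split; first by rewrite /next J0 addr0.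
  move=> x Ux; rewrite -[X in is_derive _ _ _ X]add0r.
  by have := dJ _ Ux => ?; apply: is_deriveD.
(* One Picard step halves the distance in the norm weighted by E. *)
have nextB Y Z K : 0 <= K -> (forall i x, U x -> {for x, continuous (Y i)}) ->
  (forall i x, U x -> {for x, continuous (Z i)}) ->
  (forall i x, U x -> `|Y i x - Z i x| <= K * E x) ->
  forall i x, U x -> `|next Y i x - next Z i x| <= K / 2 * E x.
  move=> K0 Yc Zc YZ i.
  have [Y0 dY] := nextP _ Yc i; have [Z0 dZ] := nextP _ Zc i.
  apply: (@derivative_comparison U x0 m B (next Y i \- next Z i)
    (fun x => c i x * Y (~~ i) x - c i x * Z (~~ i) x)) => //=.
  - by move=> x Ux; have := dY _ Ux; have := dZ _ Ux => ? ?; apply: is_deriveB.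
  - by rewrite Y0 Z0 subrr.
  - move=> x Ux; rewrite -mulrBr normrM (mulrC K) -mulrA.
    by apply: ler_pM => //; exact: YZ.
pose Y n := iter n next (fun i _ => a i).
have Yc n i x : U x -> {for x, continuous (Y n i)}.
  elim: n i x => [|n IH] i x Ux; first exact: cvg_cst.
  by have [_ /(_ _ Ux)/is_derive_continuous] := nextP _ IH i.
pose K := `|a true| + `|a false|.
have K0 : 0 <= K by rewrite addr_ge0.
have YS n i x : U x -> `|Y n.+1 i x - Y n i x| <= K * E x / 2 ^+ n.
  rewrite mulrAC.
  elim: n i x => [|n IH] i x Ux.
    rewrite expr0 divr1 /=.
    have [N0 dN] := nextP _ (Yc 0%N) i.
    apply: (@le_trans _ _ (K / 2 * E x)); last first.
      by rewrite ler_pM2r// ler_pdivrMr// ler_peMr// ler1n.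
    apply: (@derivative_comparison U x0 m B (fun x => next (Y 0%N) i x - a i)
       (fun x => c i x * a (~~ i))) => //.
    + move=> z Uz; rewrite -[X in is_derive _ _ _ X]subr0.
      by have := dN _ Uz => ?; apply: is_deriveB.
    + by rewrite N0 subrr.
    + move=> z Uz; rewrite normrM (mulrC K) -mulrA.
      apply: ler_pM => //; apply: le_trans (_ : K * 1 <= _); last by apply: ler_wpM2l => //;
          exact: E_ge1.
      rewrite mulr1 /K; have := normr_ge0 (a true); have := normr_ge0 (a false).
      by case: (i) => /=; lra.
  rewrite exprSr invfM mulrA.
  have Kn : 0 <= K / 2 ^+ n by rewrite divr_ge0// exprn_ge0.
  exact: (nextB _ _ _ Kn (Yc n.+1) (Yc n) IH).
have /choice[Z ZP] : forall i, exists Z, forall x, U x ->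
    forall n, `|Z x - Y n i x| <= 2 * (K * E x) / 2 ^+ n.
  move=> i.
  have /choice[Z ZP] : forall x, exists l,
      U x -> forall n, `|l - Y n i x| <= 2 * (K * E x) / 2 ^+ n.
    move=> x; have [Ux|] := pselect (U x); last by exists 0.
    have [l lP] := geometric_limit (fun n => YS n i x Ux).
    by exists l.
  by exists Z.
have Zc i x : U x -> {for x, continuous (Z i)}.
  move=> Ux; apply/cvgrPdist_le => e e0.
  have [n ne] : exists n, 2 * (K * (E x + 1)) / 2 ^+ n <= e / 3.
    have : (2 * (K * (E x + 1)) / 2 ^+ n @[n --> \oo] --> 0)%classic.
      under eq_fun do rewrite -exprVn.
      by apply: cvg_geometric; rewrite ger0_norm ?invr_ge0// invf_lt1 ?ltr1n.
    move=> /cvgrPdist_le/(_ (e / 3)) []; first by rewrite divr_gt0.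
    move=> n _ /(_ n (leqnn _)); rewrite sub0r normrN => ne.
    by exists n; apply: le_trans ne; exact: ler_norm.
  have e30 : 0 < e / 3 by rewrite divr_gt0.
  have nU : \forall y \near x, U y by exact: oU.
  have nE : \forall y \near x, E y <= E x + 1.
    have /cvgrPdist_le/(_ 1 ltr01) := Ec _ Ux.
    by apply: filterS => y; rewrite ler_norml => /andP[]; lra.
  have nY : \forall y \near x, `|Y n i x - Y n i y| <= e / 3.
    by have /cvgrPdist_le/(_ _ e30) := Yc n i _ Ux.
  have tail y : U y -> E y <= E x + 1 -> `|Z i y - Y n i y| <= e / 3.
    move=> Uy Ey; apply: le_trans (ZP i y Uy n) _; apply: le_trans ne.
    by rewrite ler_pM2r ?invr_gt0 ?exprn_gt0// ler_pM2l// ler_wpM2l.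
  near=> y.
  have Ex1 : E x <= E x + 1 by rewrite lerDl.
  have tx := tail _ Ux Ex1.
  have ty : `|Z i y - Y n i y| <= e / 3 by apply: tail; near: y.
  have txy : `|Y n i x - Y n i y| <= e / 3 by near: y.
  move: tx ty txy; rewrite !ler_norml => /andP[? ?] /andP[? ?] /andP[? ?].
  by apply/andP; split; lra.
(* Z is only a pointwise limit; next Z is differentiable, and equals Z because
   both are within O(2^-n) of the same iterate. *)
exists (next Z); split=> [i|i x Ux]; first by have [] := nextP _ Zc i.
have [_ /(_ _ Ux)] := nextP _ Zc i.
suff -> : Z (~~ i) x = next Z (~~ i) x by [].
apply/eqP; rewrite -subr_eq0; apply/eqP/(@geometric_bound_eq0 _ (2 * (K * E x))) => n.
have := ZP (~~ i) x Ux n.+1.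
have YZ j z : U z -> `|Y n j z - Z j z| <= 2 * K / 2 ^+ n * E z.
  move=> Uz; rewrite distrC; apply: le_trans (ZP j z Uz n) _.
  by rewrite le_eqVlt; apply/orP; left; apply/eqP; ring.
have Kn : 0 <= 2 * K / 2 ^+ n by rewrite divr_ge0 ?mulr_ge0 ?exprn_ge0.
have := nextB _ _ _ Kn (Yc n) Zc YZ (~~ i) x Ux.
rewrite exprSr invfM => YN ZY; rewrite -(subrKA (Y n.+1 (~~ i) x)).
apply: le_trans (ler_normD _ _) _; apply: le_trans (lerD ZY YN) _.
by rewrite le_eqVlt; apply/orP; left; apply/eqP; field; rewrite expf_neq0.
Unshelve. all: by end_near. Qed.
End OneVariable.

(** * Lines *)

Section Lines.
Context {R : realType}.

Lemma is_derive_affine (a b s : R) : is_derive s (1 : R) (fun r => a + r * b) b.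
Proof.
have -> : (fun r => a + r * b) = cst a + (b \*: id).
  by apply/funext => r; rewrite !fctE mulrC.
by apply: is_derive_eq; rewrite add0r /GRing.scale /= mulr1.
Qed.

(** A directional derivative is the derivative along a line; this reduces the
    derivatives on R^n below to derivatives of curves. *)
Lemma is_derive_line (V W : normedModType R) (f : V -> W) x v d :
  is_derive (0 : R) (1 : R) (fun h => f (h *: v + x)) d -> is_derive x v f d.
Proof.
move=> [df fE]; apply: DeriveDef; first exact: ((derivable1P f x v).2 df).
rewrite -fE /derive; set g1 := fun h => h^-1 *: _; set g2 := fun h => h^-1 *: _.
suff -> : g1 = g2 by [].
by apply/funext => h; rewrite /g1 /g2 /= scale0r add0r addr0 [_%:A]mulr1.
Qed.

Lemma smooth_on_cst (c : R) : smooth_on setT (cst c).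
Proof.
move=> k x _; suff [d ->] : exists d, ((cst c)^`(k))%classic = cst d by exact: derivable_cst.
elim: k => [|k [d IH]]; first by exists c.
by exists 0; rewrite derive1nS IH; apply/funext => r; rewrite derive1E derive_cst.
Qed.

Definition line n (u v : 'rV[R]_n) (s : R) := u + s *: v.

Lemma is_derive_line_coord n (u v : 'rV[R]_n) i s :
  is_derive s (1 : R) (fun r => line u v r 0 i) (v 0 i).
Proof.
have -> : (fun r => line u v r 0 i) = fun r => u 0 i + r * v 0 i.
  by apply/funext => r; rewrite 2!mxE.
exact: is_derive_affine.
Qed.

Lemma smooth_line n (u v : 'rV[R]_n) i : smooth_on setT (fun s => line u v s 0 i).
Proof.
have D1 : (fun s => line u v s 0 i)^`()%classic = cst (v 0 i).
  by apply/funext => s; rewrite derive1E; have [_ ->] := is_derive_line_coord u v i s.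
case=> [|k] s _; first by have [] := is_derive_line_coord u v i s.
by rewrite derive1Sn D1; exact: smooth_on_cst.
Qed.

End Lines.

(** * The Levi-Civita connection in a moving frame *)

Section LeviCivitaFrame.
Context {R : realType} {n : nat}.
Implicit Types (g : tensor2 R n) (p : 'rV[R]_n) (E : 'rV[R]_n -> 'M[R]_n).

Lemma is_derive_sumE (V : normedModType R) m (h : 'I_m -> V -> R) (dh : 'I_m -> R) x v :
  (forall i, is_derive x v (h i) (dh i)) ->
  is_derive x v (fun y => \sum_(i < m) h i y) (\sum_(i < m) dh i).
Proof.
move=> H; have -> : (fun y => \sum_(i < m) h i y) = \sum_(i < m) h i.
  by apply/funext => y; rewrite fct_sumE.
exact: is_derive_sum.
Qed.

Lemma is_derive_mulE (V : normedModType R) (f g : V -> R) df dg x v :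
  is_derive x v f df -> is_derive x v g dg ->
  is_derive x v (fun y => f y * g y) (df * g x + f x * dg).
Proof.
move=> Hf Hg; rewrite addrC mulrC [df * _]mulrC mulrC; exact: is_deriveM.
Qed.

Lemma levi_civitaE g p i j k : levi_civita g p i j k = christoffel g p j i k.
Proof.
rewrite /levi_civita mxE /covariant derive_cst add0r mxE.
rewrite (bigD1 i) //= (bigD1 k) //= !mxE !eqxx /= !mulr1 !big1 ?addr0//.
  move=> l li; rewrite big1// => m _.
  by rewrite !mxE (negbTE li) andbF mulr0 mul0r.
by move=> l lk; rewrite !mxE (negbTE lk) andbF mulr0.
Qed.

(** If a coframe E has constant Gram matrix eta, and theta is a connection form
    with values in so(eta) without torsion, then the covariant derivative is
    the ordinary one corrected by theta, read in the coframe.  With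
    L r = E^T eta (dE r + theta r E), skewness of eta theta gives
    d_r g = L r + (L r)^T and the vanishing torsion is a symmetry of L in two
    indices; the six terms of the Koszul formula then collapse to two copies of
    the same entry of L.  Thus no Christoffel symbol is ever computed. *)
Lemma levi_civita_frame g p E (eta : 'M[R]_n) (dcoframe theta : 'I_n -> 'M[R]_n) :
  eta^T = eta -> eta \in unitmx -> E p \in unitmx ->
  (\forall q \near p, gram g q = (E q)^T *m eta *m E q) ->
  (forall i a j, is_derive p (unit_vec i) (fun q => E q a j) (dcoframe i a j)) ->
  (forall i, (eta *m theta i)^T = - (eta *m theta i)) ->
  (forall i j a, (dcoframe i + theta i *m E p) a j = (dcoframe j + theta j *m E p) a i) ->
  forall i, levi_civita g p i = invmx (E p) *m (dcoframe i + theta i *m E p).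
Proof.
move=> etaT etau Eu gE dEP skew tors i.
pose X i := dcoframe i + theta i *m E p.
pose L i := (E p)^T *m eta *m X i.
have dgram r j l : 'D_(unit_vec r) (fun q => gram g q j l) p = L r j l + L r l j.
  have -> : L r j l + L r l j = (L r + (L r)^T) j l by rewrite !mxE.
  have -> : L r + (L r)^T = (dcoframe r)^T *m eta *m E p + (E p)^T *m eta *m dcoframe r.
    have BT : ((E p)^T *m eta *m (theta r *m E p))^T =
        - ((E p)^T *m eta *m (theta r *m E p)).
      rewrite -!mulmxA [eta *m _]mulmxA trmx_mul trmx_mul trmxK skew.
      by rewrite mulmxN mulNmx mulmxA.
    have AT : ((E p)^T *m eta *m dcoframe r)^T = (dcoframe r)^T *m eta *m E p.
      by rewrite !trmx_mul trmxK etaT mulmxA.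
    by rewrite /L /X mulmxDr linearD /= AT BT addrACA subrr addr0 addrC.
  have -> : 'D_(unit_vec r) (fun q => gram g q j l) p =
      'D_(unit_vec r) (fun q => \sum_b (\sum_a E q a j * eta a b) * E q b l) p.
    apply: near_eq_derive; apply: filterS gE => q ->.
    rewrite mxE; apply: eq_bigr => b _; rewrite mxE; congr (_ * _).
    by apply: eq_bigr => a _; rewrite mxE.
  pose d := \sum_b ((\sum_a dcoframe r a j * eta a b) * E p b l +
      (\sum_a E p a j * eta a b) * dcoframe r b l).
  transitivity d.
    apply: (@derive_val _ _ _ _ _ _ d).
    apply: is_derive_sumE => b; apply: is_derive_mulE.
    apply: is_derive_sumE => a.
    rewrite -[X in is_derive _ _ _ X]addr0 -[X in _ + X](mulr0 (E p a j)).
    exact: is_derive_mulE.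
  rewrite /d big_split /= mxE; congr (_ + _).
    rewrite mxE; apply: eq_bigr => b _; rewrite mxE; congr (_ * _).
    by apply: eq_bigr => a _; rewrite mxE.
  rewrite mxE; apply: eq_bigr => b _; rewrite mxE; congr (_ * _).
  by apply: eq_bigr => a _; rewrite mxE.
have Ltors r l j : L r l j = L j l r.
  by rewrite /L mxE [RHS]mxE; apply: eq_bigr => a _; congr (_ * _); exact: tors.
have gp : gram g p = (E p)^T *m eta *m E p by exact: nbhs_singleton gE.
apply/matrixP => j k; rewrite levi_civitaE /christoffel.
have -> : invmx (E p) *m (dcoframe i + theta i *m E p) = invmx (gram g p) *m L i.
  have gu : gram g p \in unitmx by rewrite gp !unitmx_mul unitmx_tr etau Eu.
  apply: (canRL (mulKmx gu)).
  by rewrite gp -!mulmxA (mulmxA (E p)) mulmxV// mul1mx /L mulmxA.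
rewrite [RHS]mxE mulr_sumr; apply: eq_bigr => l _; rewrite !dgram.
rewrite (Ltors i k l) (Ltors k i l) (Ltors k l i).
by field.
Qed.
End LeviCivitaFrame.

(** * Matrix-valued curves *)

Section MatrixCurves.
Context {R : realType}.

Definition mderiv m n (M : R -> 'M[R]_(m, n)) (s : R) (dM : 'M[R]_(m, n)) :=
  forall i j, is_derive s (1 : R) (fun r => M r i j) (dM i j).

Lemma mderiv_cst m n (A : 'M[R]_(m, n)) s : mderiv (cst A) s 0.
Proof. by move=> i j; rewrite mxE; exact: is_derive_cst. Qed.

Lemma mderivD m n (A B : R -> 'M[R]_(m, n)) s dA dB : mderiv A s dA -> mderiv B s dB ->
  mderiv (fun r => A r + B r) s (dA + dB).
Proof.
move=> HA HB i j; rewrite mxE.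
have -> : (fun r => (A r + B r) i j) = (fun r => A r i j) + (fun r => B r i j).
  by apply/funext => r; rewrite mxE.
exact: is_deriveD.
Qed.

Lemma mderivZ m n (A : R -> 'M[R]_(m, n)) s c dA : mderiv A s dA ->
  mderiv (fun r => c *: A r) s (c *: dA).
Proof.
move=> HA i j; rewrite mxE.
have -> : (fun r => (c *: A r) i j) = c *: (fun r => A r i j).
  by apply/funext => r; rewrite mxE.
exact: is_deriveZ.
Qed.

Lemma mderivM m n p (A : R -> 'M[R]_(m, n)) (B : R -> 'M[R]_(n, p)) s dA dB :
  mderiv A s dA -> mderiv B s dB ->
  mderiv (fun r => A r *m B r) s (dA *m B s + A s *m dB).
Proof.
move=> HA HB i j.
have -> : (fun r => (A r *m B r) i j) = fun r => \sum_k A r i k * B r k j.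
  by apply/funext => r; rewrite mxE.
have -> : (dA *m B s + A s *m dB) i j = \sum_k (dA i k * B s k j + A s i k * dB k j).
  by rewrite !mxE -big_split.
by apply: is_derive_sumE => k; exact: is_derive_mulE.
Qed.

Lemma derivable_bigop (op : R -> R -> R) (idx : R) (T : Type) (l : seq T) (P : pred T)
  (F : T -> R -> R) (s : R) :
  (forall f g : R -> R, derivable f s 1 -> derivable g s 1 ->
    derivable (fun r => op (f r) (g r)) s 1) ->
  (forall i, derivable (F i) s 1) ->
  derivable (fun r => \big[op/idx]_(i <- l | P i) F i r) s 1.
Proof.
move=> dop dF; elim: l => [|i l IH].
  by under eq_fun do rewrite big_nil; exact: derivable_cst.
under eq_fun do rewrite big_cons; case: (P i) => //.
exact: dop.
Qed.

Lemma derivable_det n (M : R -> 'M[R]_n) (s : R) :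
  (forall i j, derivable (fun r => M r i j) s 1) ->
  derivable (fun r => \det (M r)) s 1.
Proof.
move=> dM; rewrite /determinant.
have dmul (f g : R -> R) : derivable f s 1 -> derivable g s 1 ->
    derivable (fun r => f r * g r) s 1 by exact: derivableM.
apply: derivable_bigop => [f g df dg|sg]; first exact: derivableD.
apply: (dmul); first exact: derivable_cst.
by apply: (@derivable_bigop *%R 1); [exact: dmul|move=> i; exact: dM].
Qed.

(** Differentiability of the inverse comes from Cramer's rule; its value then
    follows by differentiating M M^-1 = 1. *)
Lemma mderiv_inv n (M : R -> 'M[R]_n) s dM : M s \in unitmx -> mderiv M s dM ->
  mderiv (fun r => invmx (M r)) s (- (invmx (M s) *m dM *m invmx (M s))).
Proof.
move=> Mu HM.
have dM' i j : derivable (fun r => M r i j) s 1 by have [] := HM i j.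
have ddet := derivable_det dM'.
have det0 : \det (M s) != 0 by rewrite -unitfE -unitmxE.
have Munit : \forall r \near s, M r \in unitmx.
  have cdet : {for s, continuous (fun r => \det (M r))}.
    by apply: differentiable_continuous; apply/derivable1_diffP.
  have : \forall r \near s, \det (M r) != 0.
    have := cdet [set x : R | x != 0]; apply.
    by apply: open_nbhs_nbhs; split => //; exact: open_neq.
  by apply: filterS => r; rewrite unitmxE unitfE.
have dinv i j : derivable (fun r => invmx (M r) i j) s 1.
  apply: (@near_eq_derivable _ _ _ (fun r => (\det (M r))^-1 * cofactor (M r) j i)).
    by apply: filterS Munit => r ru; rewrite /invmx ru !mxE.
  apply: derivableM; first exact: derivableV.
  rewrite /cofactor; apply: derivableM; first exact: derivable_cst.
  by apply: derivable_det => k l; under eq_fun do rewrite !mxE; exact: dM'.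
pose dI : 'M[R]_n := \matrix_(i, j) 'D_1 (fun r => invmx (M r) i j) s.
have HI : mderiv (fun r => invmx (M r)) s dI.
  by move=> i j; rewrite mxE; exact: derivableP.
suff <- : dI = - (invmx (M s) *m dM *m invmx (M s)) by [].
have : dM *m invmx (M s) + M s *m dI = 0.
  apply/matrixP => i j; rewrite [RHS]mxE.
  have [_ <-] := mderivM HM HI i j.
  rewrite -(derive_cst ((1%:M : 'M[R]_n) i j) s 1); apply: near_eq_derive.
  by apply: filterS Munit => r ru; rewrite mulmxV.
move/eqP; rewrite addrC addr_eq0 => /eqP/(congr1 (mulmx (invmx (M s)))).
by rewrite mulKmx// mulmxN mulmxA.
Qed.

Lemma mderiv_eq_cst m n (M : R -> 'M[R]_(m, n)) (U : set R) a b :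
  is_interval U -> (forall s, U s -> mderiv M s 0) -> U a -> U b -> M a = M b.
Proof.
move=> iU dM Ua Ub; apply/matrixP => i j.
have [|c [_ _ /eqP]] := @MVT_interval _ U (fun s => M s i j) (fun=> 0) a b iU _ Ua Ub.
  by move=> s Us; have := dM _ Us i j; rewrite mxE.
by rewrite mul0r subr_eq0 => /eqP.
Qed.

(** Two solutions of Y' = B Y differ by a constant right factor, since
    Y^-1 Z has zero derivative. *)
Lemma mderiv_unique n p (B : R -> 'M[R]_n) (Y : R -> 'M[R]_n) (Z : R -> 'M[R]_(n, p))
  (U : set R) a b : is_interval U -> (forall s, U s -> Y s \in unitmx) ->
  (forall s, U s -> mderiv Y s (B s *m Y s)) ->
  (forall s, U s -> mderiv Z s (B s *m Z s)) -> U a -> U b ->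
  invmx (Y a) *m Z a = invmx (Y b) *m Z b.
Proof.
move=> iU Yu dY dZ; apply: (mderiv_eq_cst (M := fun s => invmx (Y s) *m Z s)) => // s Us.
have := mderivM (mderiv_inv (Yu _ Us) (dY _ Us)) (dZ _ Us).
by rewrite mulNmx -!mulmxA mulKVmx ?Yu// addNr.
Qed.

End MatrixCurves.

(** * Smooth functions on R^n *)

Section Smooth.
Context {R : realType} {n : nat}.
Implicit Types f g : 'rV[R]_n -> R.

Lemma CkS k f : Ck k.+1 f -> Ck k f.
Proof.
elim: k f => [|k IH] f [cf df]; first by split.
by split=> // i; have [? /IH ?] := df i.
Qed.

Lemma smooth_cst (c : R) : smooth (fun _ : 'rV[R]_n => c).
Proof.
move=> k; elim: k c => [|k IH] c; split => //; [exact: cst_continuous|exact: cst_continuous|].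
move=> i; split=> [x|]; first exact: derivable_cst.
have -> : (fun x : 'rV[R]_n => 'D_(unit_vec i) (fun=> c) x) = fun=> 0.
  by apply/funext => x; rewrite derive_cst.
exact: IH.
Qed.

Lemma is_derive_coord (x v : 'rV[R]_n) j : is_derive x v (fun y : 'rV[R]_n => y 0 j) (v 0 j).
Proof.
have [df dcoframe] := is_derive_id x v.
have d : forall i k, derivable (fun y : 'rV[R]_n => y i k) x v by apply/derivable_mxP.
apply: DeriveDef; first exact: d.
by rewrite -[in RHS]dcoframe derive_mx// mxE.
Qed.

Lemma smooth_coord j : smooth (fun x : 'rV[R]_n => x 0 j).
Proof.
have c : continuous (fun x : 'rV[R]_n => x 0 j) by move=> x; exact: coord_continuous.
case=> [|k]; split => // i; split=> [x|]; first by have [] := is_derive_coord x (unit_vec i) j.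
have -> : (fun x : 'rV[R]_n => 'D_(unit_vec i) (fun y : 'rV[R]_n => y 0 j) x) =
    fun=> unit_vec i 0 j.
  by apply/funext => x; have [_] := is_derive_coord x (unit_vec i) j.
exact: smooth_cst.
Qed.

Lemma CkD k f g : Ck k f -> Ck k g -> Ck k (fun x => f x + g x).
Proof.
have cD (u v : 'rV[R]_n -> R) : continuous u -> continuous v -> continuous (fun x => u x + v x).
  by move=> cu cv x; exact: (continuousD (cu x) (cv x)).
elim: k f g => [|k IH] f g [cf df] [cg dg]; split => //; [exact: cD|exact: cD|].
move=> i; have [dfi Cfi] := df i; have [dgi Cgi] := dg i; split => [x|].
  exact: derivableD.
have -> : (fun x => 'D_(unit_vec i) (fun y => f y + g y) x)
    = fun x => 'D_(unit_vec i) f x + 'D_(unit_vec i) g x.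
  by apply/funext => x; rewrite -deriveD.
exact: IH.
Qed.

Lemma CkM k f g : Ck k f -> Ck k g -> Ck k (fun x => f x * g x).
Proof.
have cM (u v : 'rV[R]_n -> R) : continuous u -> continuous v -> continuous (fun x => u x * v x).
  by move=> cu cv x; exact: (continuousM (cu x) (cv x)).
elim: k f g => [|k IH] f g /[dup] Cf [cf df] /[dup] Cg [cg dg]; split => //;
  [exact: cM|exact: cM|].
move=> i; have [dfi Cfi] := df i; have [dgi Cgi] := dg i; split => [x|].
  exact: derivableM.
have -> : (fun x => 'D_(unit_vec i) (fun y => f y * g y) x)
    = fun x => f x * 'D_(unit_vec i) g x + g x * 'D_(unit_vec i) f x.
  by apply/funext => x; rewrite (deriveM (dfi x) (dgi x)).
by apply: CkD; apply: IH => //; exact: CkS.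
Qed.

Lemma smoothD f g : smooth f -> smooth g -> smooth (fun x => f x + g x).
Proof. by move=> Sf Sg k; exact: CkD. Qed.

Lemma smoothM f g : smooth f -> smooth g -> smooth (fun x => f x * g x).
Proof. by move=> Sf Sg k; exact: CkM. Qed.

Lemma smooth_sum m (F : 'I_m -> 'rV[R]_n -> R) : (forall i, smooth (F i)) ->
  smooth (fun x => \sum_i F i x).
Proof.
move=> SF; elim: (index_enum _) => [|i l IH].
  by under eq_fun do rewrite big_nil; exact: smooth_cst.
by under eq_fun do rewrite big_cons; exact: smoothD.
Qed.

Lemma smooth_mulmx a b c (A : 'rV[R]_n -> 'M[R]_(a, b)) (B : 'rV[R]_n -> 'M[R]_(b, c)) :
  (forall i j, smooth (fun x => A x i j)) -> (forall i j, smooth (fun x => B x i j)) ->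
  forall i j, smooth (fun x => (A x *m B x) i j).
Proof.
move=> SA SB i j; under eq_fun do rewrite mxE.
by apply: smooth_sum => k; exact: smoothM.
Qed.
End Smooth.

(** * A faithful matrix model of the Heisenberg group *)

Section Coordinates.
Lemma ord0_7 : (ord0 : 'I_7) = 0. Proof. exact/val_inj. Qed.
Lemma ord_max_7 : (ord_max : 'I_7) = 6. Proof. exact/val_inj. Qed.
Lemma midE : (mid 0 = 1) * (mid 1 = 2) * (mid 2 = 3) * (mid 3 = 4) * (mid 4 = 5).
Proof. by do !split; apply/val_inj. Qed.
Lemma sum_ord7 (V : zmodType) (F : 'I_7 -> V) :
  \sum_i F i = F 0 + F 1 + F 2 + F 3 + F 4 + F 5 + F 6.
Proof.
rewrite !big_ord_recl big_ord0 addr0 !addrA.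
by do ![congr (_ + _)|congr F; exact/val_inj].
Qed.
Lemma ord7_ind (Q : 'I_7 -> Prop) :
  Q 0 -> Q 1 -> Q 2 -> Q 3 -> Q 4 -> Q 5 -> Q 6 -> forall i, Q i.
Proof.
move=> Q0 Q1 Q2 Q3 Q4 Q5 Q6 [[|[|[|[|[|[|[|//]]]]]]] lt7].
- by rewrite (_ : Ordinal lt7 = 0)//; exact/val_inj.
- by rewrite (_ : Ordinal lt7 = 1)//; exact/val_inj.
- by rewrite (_ : Ordinal lt7 = 2)//; exact/val_inj.
- by rewrite (_ : Ordinal lt7 = 3)//; exact/val_inj.
- by rewrite (_ : Ordinal lt7 = 4)//; exact/val_inj.
- by rewrite (_ : Ordinal lt7 = 5)//; exact/val_inj.
- by rewrite (_ : Ordinal lt7 = 6)//; exact/val_inj.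
Qed.
Lemma ord5_ind (Q : 'I_5 -> Prop) : Q 0 -> Q 1 -> Q 2 -> Q 3 -> Q 4 -> forall i, Q i.
Proof.
move=> Q0 Q1 Q2 Q3 Q4 [[|[|[|[|[|//]]]]] lt5].
- by rewrite (_ : Ordinal lt5 = 0)//; exact/val_inj.
- by rewrite (_ : Ordinal lt5 = 1)//; exact/val_inj.
- by rewrite (_ : Ordinal lt5 = 2)//; exact/val_inj.
- by rewrite (_ : Ordinal lt5 = 3)//; exact/val_inj.
- by rewrite (_ : Ordinal lt5 = 4)//; exact/val_inj.
Qed.
End Coordinates.

Section Exponential.
Context {R : realType}.
Implicit Types x y z v : 'rV[R]_5.

(** The copy of h_5 in so(eta) that contains the connection form.  R^7 is graded
    as R^2 + S^2 R^2 + R^2 (coordinates 0-1, 2-4, 5-6); the coordinates 0-3 of x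
    act by maps of degree one and, in the order x0, x1, - x3 / 3, x2, form the
    module S^3 R^2 of SL_2, and the coordinate 4 acts by the SL_2-invariant map
    of degree two.  The factors 1 / 3 and 1 / 2 make the
    symplectic form of S^3 R^2 the standard one of h_5 (h5_mx_comm). *)
Definition h5_mx (x : 'rV[R]_5) : 'M[R]_7 :=
  \matrix_(i, j)
    match val i, val j with
    | 2%N, 0%N => - x 0 1
    | 2%N, 1%N => x 0 0
    | 3%N, 0%N => x 0 3 / 3
    | 3%N, 1%N => x 0 1
    | 4%N, 0%N => - x 0 2
    | 4%N, 1%N => - x 0 3 / 3
    | 5%N, 1%N => - x 0 4 / 2
    | 5%N, 2%N => x 0 2 / 2
    | 5%N, 3%N => x 0 3 / 3
    | 5%N, 4%N => x 0 1 / 2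
    | 6%N, 0%N => x 0 4 / 2
    | 6%N, 2%N => x 0 3 / 6
    | 6%N, 3%N => x 0 1
    | 6%N, 4%N => - x 0 0 / 2
    | _, _ => 0
    end.

Lemma h5_mx_sum (x : 'rV[R]_5) (c : 'I_7 -> R) (r := fun a => \sum_b h5_mx x a b * c b) :
  ((r 0 = 0) * (r 1 = 0) *
  (r 2 = (x 0 0 * c 1 - x 0 1 * c 0)%R) *
  (r 3 = (x 0 1 * c 1 + x 0 3 / 3 * c 0)%R) *
  (r 4 = (- x 0 2 * c 0 - x 0 3 / 3 * c 1)%R) *
  (r 5 = (x 0 2 / 2 * c 2 + x 0 3 / 3 * c 3 + x 0 1 / 2 * c 4 - x 0 4 / 2 * c 1)%R) *
  (r 6 = (x 0 3 / 6 * c 2 + x 0 1 * c 3 - x 0 0 / 2 * c 4 + x 0 4 / 2 * c 0)%R))%type.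
Proof. by rewrite /r; do !split; rewrite sum_ord7 !mxE /=; field. Qed.

Lemma h5_mx_lin a x y : h5_mx (a *: x + y) = a *: h5_mx x + h5_mx y.
Proof.
by apply/matrixP; apply: ord7_ind; apply: ord7_ind; rewrite !mxE /=; field.
Qed.
Lemma h5_mxD x y : h5_mx (x + y) = h5_mx x + h5_mx y.
Proof. by rewrite -[x]scale1r h5_mx_lin !scale1r. Qed.
Lemma h5_mx0 : h5_mx 0 = 0 :> 'M[R]_7.
Proof. by have := h5_mx_lin (-1) 0 0; rewrite scaler0 add0r scaleN1r addNr. Qed.
Lemma h5_mxZ a x : h5_mx (a *: x) = a *: h5_mx x.
Proof. by rewrite -[a *: x]addr0 h5_mx_lin h5_mx0 addr0. Qed.

Lemma h5_mx_mulE m x (A : 'M[R]_(7, m)) i j : (h5_mx x *m A) i j =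
  nth 0 [:: 0; 0; x 0 0 * A 1 j - x 0 1 * A 0 j;
   x 0 1 * A 1 j + x 0 3 / 3 * A 0 j; - x 0 2 * A 0 j - x 0 3 / 3 * A 1 j;
   x 0 2 / 2 * A 2 j + x 0 3 / 3 * A 3 j + x 0 1 / 2 * A 4 j - x 0 4 / 2 * A 1 j;
   x 0 3 / 6 * A 2 j + x 0 1 * A 3 j - x 0 0 / 2 * A 4 j + x 0 4 / 2 * A 0 j] i.
Proof.
by rewrite mxE; have /= := h5_mx_sum x (fun b => A b j); move: i; apply: ord7_ind => ->.
Qed.

Lemma h5_mx_comm x y : h5_mx x *m h5_mx y - h5_mx y *m h5_mx x = h5_mx (h5_bracket x y).
Proof.
have : exists2 w, h5_bracket x y = w & [/\ w 0 0 = 0, w 0 1 = 0, w 0 2 = 0, w 0 3 = 0 &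
    w 0 4 = x 0 0 * y 0 2 - x 0 2 * y 0 0 + (x 0 1 * y 0 3 - x 0 3 * y 0 1)].
  exists (h5_bracket x y) => //; rewrite /h5_bracket /unit_vec !mxE /=.
  by rewrite !mulr0 mulr1.
move=> [w -> [w0 w1 w2 w3 w4]].
apply/matrixP => i j; rewrite mxE [X in _ + X]mxE !h5_mx_mulE.
by move: i; apply: ord7_ind => /=; move: j; apply: ord7_ind;
  rewrite !mxE /= ?(w0, w1, w2, w3, w4); field.
Qed.

Lemma h5_mx_nil x y z : h5_mx x *m (h5_mx y *m h5_mx z) = 0.
Proof.
apply/matrixP => i j; rewrite [RHS]mxE !h5_mx_mulE /=.
by move: i; apply: ord7_ind => /=; rewrite ?mxE /=; field.
Qed.

(** The exponential series stops here because all triple products vanish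
    (h5_mx_nil). *)
Definition H5_exp x : 'M[R]_7 := 1%:M + h5_mx x + 2^-1 *: (h5_mx x *m h5_mx x).

Lemma H5_exp0 : H5_exp 0 = 1%:M.
Proof. by rewrite /H5_exp h5_mx0 mul0mx scaler0 !addr0. Qed.

Lemma H5_expM x y : H5_exp (H5_mul x y) = H5_exp x *m H5_exp y.
Proof.
have nil3 (a b c : 'rV[R]_5) : h5_mx a *m h5_mx b *m h5_mx c = 0 by rewrite -mulmxA;
    exact: h5_mx_nil.
have NH : h5_mx (H5_mul x y) = h5_mx x + h5_mx y + 2^-1 *: (h5_mx x *m h5_mx y - h5_mx y *m
    h5_mx x).
  by rewrite /H5_mul !h5_mxD h5_mxZ h5_mx_comm.
have NH2 : h5_mx (H5_mul x y) *m h5_mx (H5_mul x y) = (h5_mx x + h5_mx y) *m (h5_mx x + h5_mx y).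
  rewrite {2}NH mulmxDr -scalemxAr mulmxBr !h5_mx_nil subrr scaler0 addr0.
  rewrite NH mulmxDl -scalemxAl mulmxBl !mulmxDr !nil3 !addr0 subrr scaler0.
  by rewrite addr0.
rewrite /H5_exp NH2 NH !mulmxDl !mulmxDr !mul1mx !mulmx1.
rewrite -!scalemxAl -!scalemxAr !mulmxA !nil3 !mul0mx !scaler0 !addr0.
apply/matrixP => i j; rewrite !mxE.
by set a := \sum_(k < _) _; set b := \sum_(k < _) _; set c := \sum_(k < _) _;
   set d := \sum_(k < _) _; field.
Qed.

Lemma H5_expNK x : H5_exp (- x) *m H5_exp x = 1%:M.
Proof. by rewrite -H5_expM H5_mulNx H5_exp0. Qed.

Lemma H5_exp_unit x : H5_exp x \in unitmx.
Proof. by have /mulmx1_unit[] := H5_expNK x. Qed.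

Lemma invmx_H5_exp x : invmx (H5_exp x) = H5_exp (- x).
Proof. by rewrite -[RHS](mulmxK (H5_exp_unit x)) H5_expNK mul1mx. Qed.

Lemma H5_exp_inj : injective H5_exp.
Proof.
move=> x y xy.
have H i j : H5_exp x i j = H5_exp y i j by rewrite xy.
have E z i j : H5_exp z i j = (i == j)%:R + h5_mx z i j + 2^-1 * (h5_mx z *m h5_mx z) i j.
  by rewrite !mxE.
have h0 : x 0 0 = y 0 0 by have := H 2 1; rewrite !E !h5_mx_mulE !mxE /=; lra.
have h1 : x 0 1 = y 0 1 by have := H 2 0; rewrite !E !h5_mx_mulE !mxE /=; lra.
have h2 : x 0 2 = y 0 2 by have := H 4 0; rewrite !E !h5_mx_mulE !mxE /=; lra.
have h3 : x 0 3 = y 0 3 by have := H 3 0; rewrite !E !h5_mx_mulE !mxE /=; lra.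
have h4 : x 0 4 = y 0 4.
  by have := H 5 1; rewrite !E !h5_mx_mulE !mxE /= h0 h1 h2 h3; lra.
by apply/rowP; apply: ord5_ind.
Qed.

End Exponential.

Section ExponentialCalculus.
Context {R : realType}.
Implicit Types x y z v : 'rV[R]_5.

Lemma h5_mx_sumE x : h5_mx x = \sum_k x 0 k *: h5_mx (unit_vec k).
Proof.
have -> : h5_mx x = h5_mx (\sum_k x 0 k *: unit_vec k) by congr h5_mx; exact: row_sum_delta.
elim: (index_enum _) => [|k l IH]; first by rewrite !big_nil h5_mx0.
by rewrite !big_cons h5_mxD h5_mxZ IH.
Qed.

Lemma mderiv_h5_mx (xi : R -> 'rV[R]_5) s dxi : mderiv xi s dxi ->
  mderiv (fun r => h5_mx (xi r)) s (h5_mx dxi).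
Proof.
move=> H i j.
have E x : h5_mx x i j = \sum_k x 0 k * h5_mx (unit_vec k) i j.
  by rewrite h5_mx_sumE summxE; apply: eq_bigr => k _; rewrite mxE.
under eq_fun do rewrite E; rewrite E.
apply: is_derive_sumE => k.
rewrite -[X in is_derive _ _ _ X]addr0 -[X in _ + X](mulr0 (xi s 0 k)).
by apply: is_derive_mulE; exact: H.
Qed.

(** The logarithmic derivative of the exponential in a 2-step nilpotent
    algebra. *)
Lemma mderiv_H5_exp (xi : R -> 'rV[R]_5) s dxi : mderiv xi s dxi ->
  mderiv (fun r => H5_exp (xi r)) s
    (h5_mx (dxi + 2^-1 *: h5_bracket (xi s) dxi) *m H5_exp (xi s)).
Proof.
move=> H; have HN := mderiv_h5_mx H.
have := mderivD (mderivD (mderiv_cst 1%:M s) HN) (mderivZ 2^-1 (mderivM HN HN)).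
congr mderiv; rewrite /H5_exp add0r h5_mxD h5_mxZ -h5_mx_comm.
have nil3 (a b c : 'rV[R]_5) : h5_mx a *m h5_mx b *m h5_mx c = 0.
  by rewrite -mulmxA; exact: h5_mx_nil.
rewrite !mulmxDr !mulmx1 !mulmxDl -!scalemxAr -!scalemxAl !mulmxDl !mulNmx.
rewrite !mulmxA !nil3 !mul0mx !(oppr0, addr0, scaler0).
apply/matrixP => i j; rewrite !mxE.
by set a := \sum_(k < _) _; set b := \sum_(k < _) _; field.
Qed.

Lemma mderiv_line (x v : 'rV[R]_5) s : mderiv (line x v) s v.
Proof. by move=> i j; rewrite !ord1; exact: is_derive_line_coord. Qed.

Lemma h5_mx_inj v : h5_mx v = 0 -> v = 0.
Proof.
move=> v0; have H i j : h5_mx v i j = 0 by rewrite v0 mxE.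
apply/rowP; apply: ord5_ind; rewrite [RHS]mxE.
- by have := H 2 1; rewrite mxE.
- by have := H 3 1; rewrite mxE.
- by have := H 4 0; rewrite mxE /= => h; lra.
- by have := H 3 0; rewrite mxE /= => h; lra.
- by have := H 6 0; rewrite mxE /= => h; lra.
Qed.

(** The parametrization x |-> E^-1 exp (x) E is polynomial.  It is an immersion
    because its derivative at x in the direction v is exp (x) multiplied by the
    matrix of v + [x, v] / 2, and v is recovered from that vector: first modulo
    the centre, where the bracket disappears, then entirely. *)
Lemma isomorphic_H5_conj (E : 'M[R]_7) : E \in unitmx ->
  isomorphic_H5 (range (fun x => invmx E *m H5_exp x *m E)).
Proof.
move=> Eu; exists (fun x => invmx E *m H5_exp x *m E); split => //.
- by move=> x y; rewrite H5_expM !mulmxA mulmxK.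
- move=> x y /(congr1 (fun A => E *m A *m invmx E)).
  by rewrite !mulmxA !mulmxK// !mulmxV// !mul1mx => /H5_exp_inj.
- have SN i j : smooth (fun x : 'rV[R]_5 => h5_mx x i j).
    have EN x : h5_mx x i j = \sum_k x 0 k * h5_mx (unit_vec k) i j.
      by rewrite h5_mx_sumE summxE; apply: eq_bigr => k _; rewrite mxE.
    under eq_fun do rewrite EN.
    by apply: smooth_sum => k; apply: smoothM; [exact: smooth_coord|exact: smooth_cst].
  have Sc (A : 'M[R]_7) i j : smooth (fun x : 'rV[R]_5 => A i j) by exact: smooth_cst.
  apply: smooth_mulmx => //; apply: smooth_mulmx => // i j.
  under eq_fun do rewrite mxE [X in X + _]mxE [X in _ + X]mxE.
  apply: smoothD; first by apply: smoothD => //; exact: Sc.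
  by apply: smoothM; [exact: smooth_cst|apply: smooth_mulmx].
- move=> x v D0.
  pose d := h5_mx (v + 2^-1 *: h5_bracket x v) *m H5_exp x.
  have dP : mderiv (fun r => invmx E *m H5_exp (line x v r) *m E) 0 (invmx E *m d *m E).
    have := mderivM (mderivM (mderiv_cst (invmx E) 0) (mderiv_H5_exp (mderiv_line x v 0))) (mderiv_cst E 0).
    by rewrite /line scale0r addr0 mul0mx add0r mulmx0 addr0.
  have dphi i j : is_derive x v (fun y => (invmx E *m H5_exp y *m E) i j) ((invmx E *m d *m E) i j).
    apply: is_derive_line; under eq_fun do rewrite addrC.
    exact: dP.
  have : invmx E *m d *m E = 0.
    rewrite -D0 derive_mx; last by apply/derivable_mxP => i j; have [] := dphi i j.
    by apply/matrixP => i j; rewrite [RHS]mxE; have [_ ->] := dphi i j.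
  move=> /(congr1 (fun A => E *m A *m invmx E)).
  rewrite !mulmxA mulmxK// mulmxV// mul1mx mulmx0 mul0mx => /(congr1 (mulmx^~ (H5_exp (- x)))).
  rewrite /= /d -mulmxA -invmx_H5_exp mulmxV ?H5_exp_unit// mulmx1 mul0mx => /h5_mx_inj w0.
  have v4 k : k != 4 -> v 0 k = 0.
    move=> k4; have := congr1 (fun w : 'rV[R]_5 => w 0 k) w0.
    by rewrite !mxE /= (negbTE k4) !mulr0 addr0.
  have br0 : h5_bracket x v = 0 by rewrite /h5_bracket !v4// !mulr0 !subrr addr0 scale0r.
  by move: w0; rewrite br0 scaler0 addr0.
Qed.

End ExponentialCalculus.

(** * Parallel transport along arcs and paths *)

Section Arcs.
Context {R : realType}.

Lemma continuous_clamp : continuous (fun s : R => Num.max 0 (Num.min 1 s)).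
Proof.
move=> s; apply: (@continuous_max R R (fun=> 0) (fun r => Num.min 1 r) s); first exact: cvg_cst.
by apply: (@continuous_min R R (fun=> 1) id s); [exact: cvg_cst|exact: cvg_id].
Qed.

(** Derivatives along arcs are two-sided also at the endpoints of [0, 1], where
    the integrand is not controlled on the other side.  Extending it by its
    boundary values gives a continuous function on R with a primitive that is
    differentiable at the endpoints too. *)
Lemma antiderivative01 (f : R -> R) :
  (forall s : R, 0 <= s <= 1 -> {for s, continuous f}) ->
  exists F : R -> R, F 0 = 0 /\ forall s : R, 0 <= s <= 1 -> is_derive s (1 : R) F (f s).
Proof.
move=> fc.
pose c (s : R) := Num.max 0 (Num.min 1 s).
have c01 s : 0 <= c s <= 1.
  by rewrite /c le_max lexx /= ge_max ler01 ge_min lexx.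
have cE s : 0 <= s <= 1 -> c s = s.
  by move=> /andP[s0 s1]; rewrite /c (min_idPr s1) (max_idPr s0).
have [|||F dF] := @antiderivative R setT (f \o c).
- exact: openT.
- by [].
- move=> s _; apply: continuous_comp; first exact: continuous_clamp.
  exact: fc.
exists (fun s => F s - F 0); split; first by rewrite subrr.
move=> s s01; have := dF s Logic.I => /=; rewrite cE// => ?.
by rewrite -[X in is_derive _ _ _ X]subr0; apply: is_deriveB.
Qed.

Lemma arc_transportE n m (A : connection n m) (g : R -> 'rV[R]_n) (B : 'M[R]_m) :
  arc_transport A g B <-> exists P : R -> 'M[R]_m, [/\ P 0 = 1%:M, P 1 = B &
    forall s : R, 0 <= s <= 1 ->
      mderiv P s (- (\sum_i (fun r => g r 0 i)^`()%classic s *: A (g s) i) *m P s)].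
Proof.
have E (P : R -> 'M[R]_m) s j k :
    ((- (\sum_i (fun r => g r 0 i)^`()%classic s *: A (g s) i)) *m P s) j k =
    - \sum_(i < n) (fun r => g r 0 i)^`()%classic s * (\sum_(l < m) A (g s) i j l * P s l k).
  rewrite mulNmx mxE mulmx_suml summxE; congr (- _); apply: eq_bigr => i _.
  by rewrite -scalemxAl mxE; congr (_ * _); rewrite mxE.
by split=> -[P [P0 P1 dP]]; exists P; split => // s s01 j k;
  [rewrite E|rewrite -E]; exact: dP.
Qed.

Lemma is_interval01 : is_interval [set s : R | 0 <= s <= 1].
Proof.
move=> a b /= /andP[a0 _] /andP[_ b1] c /andP[ac cb].
by rewrite (le_trans a0 ac) (le_trans cb b1).
Qed.

End Arcs.

Lemma invmx_mul (R : realType) n (A B : 'M[R]_n) : A \in unitmx -> B \in unitmx ->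
  invmx (A *m B) = invmx B *m invmx A.
Proof.
move=> Au Bu; have ABu : A *m B \in unitmx by rewrite unitmx_mul Au.
rewrite -[LHS]mulmx1; apply: (canLR (mulKmx ABu)).
by rewrite -mulmxA mulKVmx// mulmxV.
Qed.

(** Take a matrix of maximal rank whose rows are in T.  If its rank were less
    than n, a nonzero column of its cokernel would kill its row space but not
    T, so that T contains a further independent row. *)
Lemma subspace_full (R : realType) n (T : 'rV[R]_n -> Prop) :
  T 0 -> (forall a v w, T v -> T w -> T (a *: v + w)) ->
  (forall c : 'cV[R]_n, (forall v, T v -> v *m c = 0) -> c = 0) -> forall v, T v.
Proof.
move=> T0 Tlin Tnd.
have TZ a v : T v -> T (a *: v) by move=> Tv; rewrite -[_ *: _]addr0; exact: Tlin.
suff H k : (k <= n)%N -> exists2 M : 'M[R]_n, (k <= \rank M)%N & forall v, (v <= M)%MS -> T v.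
  have [M rM TM] := H n (leqnn n).
  move=> v; apply: TM; apply: submx_full.
  by rewrite /row_full eqn_leq rank_leq_col.
elim: k => [|k IH] kn.
  by exists 0 => // v; rewrite submx0 => /eqP->.
have [M rM TM] := IH (ltnW kn).
have [|rMk] := ltnP k (\rank M); first by exists M.
have rankM : \rank M = k by apply/eqP; rewrite eqn_leq rM rMk.
have [w Tw wM] : exists2 w, T w & ~~ (w <= M)%MS.
  apply: contrapT => nw.
  have inM v : T v -> (v <= M)%MS by move=> Tv; apply: contrapT => /negP vM; apply: nw; exists v.
  have c0 : cokermx M != 0 by rewrite -mxrank_eq0 mxrank_coker rankM subn_eq0 -ltnNge.
  case/eqP: c0; apply/matrixP => i j; rewrite [RHS]mxE.
  have := Tnd (col j (cokermx M)); move/(_ _)/matrixP/(_ i 0); rewrite !mxE; apply.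
  by move=> v /inM vM; rewrite colE mulmxA; move: vM; rewrite submxE => /eqP ->; rewrite mul0mx.
exists (M + w)%MS; last first.
  move=> v /sub_addsmxP[[a b] /= ->].
  have -> : a *m M + b *m w = b 0 0 *: w + a *m M.
    by rewrite addrC -mul_scalar_mx -mx11_scalar.
  by apply: Tlin => //; apply: TM; exact: submxMl.
rewrite -rankM; apply: rank_ltmx; rewrite ltmxE addsmxSl /=.
by apply: contra wM; apply: submx_trans; exact: addsmxSr.
Qed.

Section LineArcs.
Context {R : realType} {n : nat}.
Implicit Types u v : 'rV[R]_n.

Lemma arc_transport_rev m (A : connection n m) u v (C : 'M[R]_m) : C \in unitmx ->
  arc_transport A (line u v) C -> arc_transport A (line (u + v) (- v)) (invmx C).
Proof.
move=> Cu /arc_transportE[P [P0 P1 dP]]; apply/arc_transportE.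
exists (fun s => P (1 - s) *m invmx C); split.
- by rewrite subr0 P1 mulmxV.
- by rewrite subrr P0 mul1mx.
move=> s /andP[s0 s1].
have s01 : 0 <= 1 - s <= 1 by rewrite subr_ge0 s1 gerBl.
have lE r : line (u + v) (- v) r = line u v (1 - r).
  by rewrite /line scalerBl scale1r scalerN addrA.
have D (x y : 'rV[R]_n) i r : (fun r => line x y r 0 i)^`()%classic r = y 0 i.
  by rewrite derive1E; have [_ ->] := is_derive_line_coord x y i r.
have dPr : mderiv (fun r => P (1 - r)) s (- (- (\sum_i (fun r =>
    line u v r 0 i)^`()%classic (1 - s) *:
     A (line u v (1 - s)) i) *m P (1 - s))).
  move=> i j; have dij := dP _ s01 i j.
  rewrite mxE -mulN1r mulrC.
  apply: (@is_derive1_comp _ (fun r => P r i j) (fun r => 1 - r)) => //.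
  by have := is_deriveB (is_derive_cst (1 : R) s (1 : R)) (is_derive_id s (1 : R)); rewrite sub0r.
have := mderivM dPr (mderiv_cst (invmx C) s); congr mderiv.
rewrite mulmx0 addr0 -mulNmx opprK mulmxA; congr (_ *m _ *m _).
rewrite -sumrN; apply: eq_bigr => i _; rewrite lE !D.
by rewrite mxE scaleNr opprK.
Qed.
End LineArcs.

Section Transport.
Context {R : realType} {n m : nat}.
Variables (D : set 'rV[R]_n) (A : @connection R n m).

Lemma transport_comp p q r B C : transport D A p q B -> transport D A q r C ->
  transport D A p r (C *m B).
Proof.
move=> tB; elim=> [|g B0 C0 _ IH sg aC]; first by rewrite mul1mx.
by rewrite -mulmxA; exact: transport_arc.
Qed.

(** Transports come with a path in the opposite direction that realizes the
    inverse; for arcs obtained from lines this path is the reversed line, and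
    it makes the realized elements a group. *)
Definition rev_transport p q B :=
  [/\ transport D A p q B, transport D A q p (invmx B) & B \in unitmx].

Lemma rev_transport_comp p q r B C : rev_transport p q B -> rev_transport q r C ->
    rev_transport p r (C *m B).
Proof.
move=> [B1 B2 Bu] [C1 C2 Cu]; split; last by rewrite unitmx_mul Cu.
  exact: transport_comp C1.
by rewrite invmx_mul//; exact: transport_comp B2.
Qed.

Lemma rev_transport_sym p q B : rev_transport p q B -> rev_transport q p (invmx B).
Proof. by move=> [B1 B2 Bu]; split; rewrite ?invmxK// unitmx_inv. Qed.

Lemma transport_line p v C : smooth_arc D (line p v) -> arc_transport A (line p v) C ->
  transport D A p (p + v) C.
Proof.
move=> sl aC.
have l0 : line p v 0 = p by rewrite /line scale0r addr0.
have l1 : line p v 1 = p + v by rewrite /line scale1r.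
rewrite -[C]mulmx1 -l1; apply: transport_arc => //; rewrite l0.
apply: transport_nil; rewrite -l0; have [_] := sl; apply; by rewrite lexx ler01.
Qed.

Lemma rev_transport_line p v C : (forall s, 0 <= s <= 1 -> D (line p v s)) ->
  arc_transport A (line p v) C -> C \in unitmx -> rev_transport p (p + v) C.
Proof.
move=> Dl aC Cu.
have Dr s : 0 <= s <= 1 -> D (line (p + v) (- v) s).
  move=> /andP[s0 s1].
  have -> : line (p + v) (- v) s = line p v (1 - s).
    by rewrite /line scalerBl scale1r scalerN addrA.
  by apply: Dl; rewrite subr_ge0 s1 gerBl.
split => //; first by apply: transport_line => //; split => // i; exact: smooth_line.
rewrite -[X in transport _ _ _ X _](addrK v).
apply: transport_line; last exact: arc_transport_rev.
by split => // i; exact: smooth_line.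
Qed.
End Transport.

(** * Functions with explicit first and second derivatives *)

Section Terms.
Context {R : realType}.
Implicit Types (P V W : 'rV[R]_7).

(** Functions on R^7 built from the coordinates and from functions of the
    coordinate x = P 0 1.  A syntax for them makes the symmetry of second
    derivatives a structural induction, and lets the first derivatives of the
    coframe be computed without being written down.  [Fn f f1 f2] carries the
    first two derivatives of f along. *)
Inductive term :=
| Var of 'I_7
| Fn of (R -> R) & (R -> R) & (R -> R)
| Cst of R
| Add of term & term
| Mul of term & term.

Fixpoint teval e P : R :=
  match e with
  | Var i => P 0 i
  | Fn f _ _ => f (P 0 1)
  | Cst c => c
  | Add a b => teval a P + teval b P
  | Mul a b => teval a P * teval b P
  end.

Fixpoint tdiff e P V : R :=
  match e with
  | Var i => V 0 i
  | Fn _ f1 _ => f1 (P 0 1) * V 0 1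
  | Cst c => 0
  | Add a b => tdiff a P V + tdiff b P V
  | Mul a b => tdiff a P V * teval b P + teval a P * tdiff b P V
  end.

Fixpoint thess e P V W : R :=
  match e with
  | Var i => 0
  | Fn _ _ f2 => f2 (P 0 1) * V 0 1 * W 0 1
  | Cst c => 0
  | Add a b => thess a P V W + thess b P V W
  | Mul a b => thess a P V W * teval b P + tdiff a P W * tdiff b P V
               + (tdiff a P V * tdiff b P W + teval a P * thess b P V W)
  end.

Inductive wf_term (U : set R) : term -> Prop :=
| WfVar i : wf_term U (Var i)
| WfFn f f1 f2 :
    (forall x, U x -> is_derive x (1 : R) f (f1 x)) ->
    (forall x, U x -> is_derive x (1 : R) f1 (f2 x)) -> wf_term U (Fn f f1 f2)
| WfCst c : wf_term U (Cst c)
| WfAdd a b : wf_term U a -> wf_term U b -> wf_term U (Add a b)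
| WfMul a b : wf_term U a -> wf_term U b -> wf_term U (Mul a b).

(** This is all that the closed part of the coframe contributes to the vanishing
    of the torsion. *)
Lemma thessC e P V W : thess e P V W = thess e P W V.
Proof. by elim: e => [i|f f1 f2|c|a IHa b IHb|a IHa b IHb] //=; rewrite ?IHa ?IHb; ring. Qed.

Lemma tdiffE e P V : tdiff e P V = \sum_j V 0 j * tdiff e P (unit_vec j).
Proof.
elim: e => [i|f f1 f2|c|a IHa b IHb|a IHa b IHb] /=.
- by rewrite (bigD1 i) //= !mxE !eqxx mulr1 big1 ?addr0// => j ji;
    rewrite !mxE eqxx eq_sym (negbTE ji) mulr0.
- rewrite (bigD1 1) //= !mxE !eqxx mulr1 big1 ?addr0 1?mulrC// => j ji.
  by rewrite !mxE eqxx eq_sym (negbTE ji) !mulr0.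
- by rewrite big1// => j _; rewrite mulr0.
- by rewrite IHa IHb -big_split; apply: eq_bigr => j _; rewrite mulrDr.
- rewrite IHa IHb mulr_suml mulr_sumr -big_split; apply: eq_bigr => j _ /=.
  by ring.
Qed.

Lemma thessE e P V W : thess e P V W = \sum_j V 0 j * thess e P (unit_vec j) W.
Proof.
elim: e => [i|f f1 f2|c|a IHa b IHb|a IHa b IHb] /=.
- by rewrite big1// => j _; rewrite mulr0.
- rewrite (bigD1 1) //= !mxE !eqxx mulr1 big1 ?addr0 => [|j ji]; first by ring.
  by rewrite !mxE eqxx eq_sym (negbTE ji) !(mulr0, mul0r).
- by rewrite big1// => j _; rewrite mulr0.
- by rewrite IHa IHb -big_split; apply: eq_bigr => j _; rewrite mulrDr.
- rewrite IHa IHb (tdiffE a P V) (tdiffE b P V).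
  rewrite !mulr_suml !mulr_sumr -!big_split; apply: eq_bigr => j _ /=.
  by ring.
Qed.

Section Curve.
Variables (U : set R) (g : R -> 'rV[R]_7) (s : R) (w : 'rV[R]_7).
Hypothesis dg : forall i, is_derive s (1 : R) (fun r => g r 0 i) (w 0 i).
Hypothesis gU : U (g s 0 1).

Lemma is_derive_fn (f f1 : R -> R) : is_derive (g s 0 1) (1 : R) f (f1 (g s 0 1)) ->
  is_derive s (1 : R) (fun r => f (g r 0 1)) (f1 (g s 0 1) * w 0 1).
Proof.
by move=> df; apply: (@is_derive1_comp _ f (fun r => g r 0 1)).
Qed.

Lemma is_derive_teval e : wf_term U e ->
  is_derive s (1 : R) (fun r => teval e (g r)) (tdiff e (g s) w).
Proof.
elim=> [i|f f1 f2 df _|c|a b _ ? _ ?|a b _ ? _ ?] /=.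
- exact: dg.
- by apply: is_derive_fn; exact: df.
- exact: is_derive_cst.
- exact: is_deriveD.
- exact: is_derive_mulE.
Qed.

Lemma is_derive_tdiff e W : wf_term U e ->
  is_derive s (1 : R) (fun r => tdiff e (g r) W) (thess e (g s) w W).
Proof.
elim=> [i|f f1 f2 _ df|c|a b _ ? _ ?|a b wa ? wb ?] /=.
- exact: is_derive_cst.
- rewrite -[X in is_derive _ _ _ X]addr0 -[X in _ + X](mulr0 (f1 (g s 0 1))).
  apply: (@is_derive_mulE _ _ (fun r => f1 (g r 0 1)) (fun=> W 0 1)).
  by apply: is_derive_fn; exact: df.
- exact: is_derive_cst.
- exact: is_deriveD.
- have ? := is_derive_teval wa; have ? := is_derive_teval wb.
  by apply: is_deriveD; apply: is_derive_mulE.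
Qed.
End Curve.

End Terms.

(** * The adapted coframe *)

Section Coframe.
Context {R : realType}.
Implicit Types (P V W : 'rV[R]_7).
Variables (U : set R) (I s1 t1 s2 t2 : R -> R).

(** s'' = I s / 3, the equation of the almost Einstein scales, as a first-order
    system in s and t = s'. *)
Definition solution (s t : R -> R) := forall x, U x ->
  is_derive x (1 : R) s (t x) /\ is_derive x (1 : R) t (I x * s x / 3).

Let I_ k : R -> R := (I^`(k))%classic.
Let FnI := Fn I (I_ 1) (I_ 2).
Let FnI1 := Fn (I_ 1) (I_ 2) (I_ 3).
Let FnS (s t : R -> R) := Fn s t (fun x => I x * s x / 3).
Let FnT (s t : R -> R) :=
  Fn t (fun x => I x * s x / 3) (fun x => (I_ 1 x * s x + I x * t x) / 3).
Let t_ : term := @Var R 0.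
Let y_ : term := @Var R 2.
Let p_ : term := @Var R 3.
Let q_ : term := @Var R 4.
Let z_ : term := @Var R 5.
Let rho_ : term := @Var R 6.

(** The coefficients of si sj, (si sj)' and si' sj' in the quadratic potentials
    mij, followed by r, L and the coefficients 2 t r and - t L of si' and si in
    the potentials v1, v2. *)
Definition termH : term := Mul t_ (Add q_ (Mul (Cst (-1)) (Mul FnI y_))).
Definition termP : term := Mul (Cst (-2)) (Mul t_ p_).
Definition termS : term := Mul (Cst 6) (Mul t_ y_).
Definition termR : term :=
  Add rho_ (Mul (Cst (-2^-1)) (Add (Mul (Cst 3) (Mul q_ y_))
    (Add (Mul (Cst (-3)) (Mul FnI (Mul y_ y_))) (Mul (Cst (-2)) (Mul p_ p_))))).
Definition termL : term :=
  Add (Mul (Cst (-1)) (Mul p_ q_)) (Add (Mul (Cst (-3)) z_)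
    (Add (Mul (Cst (-2)) (Mul FnI (Mul y_ p_))) (Mul (Cst (3 / 2)) (Mul FnI1 (Mul y_ y_))))).
Definition termF : term := Mul (Cst 2) (Mul t_ termR).
Definition termG : term := Mul (Cst (-1)) (Mul t_ termL).

(** The potential mij = H si sj + P (si sj)' + S si' sj'. *)
Definition quadratic (s t s' t' : R -> R) : term :=
  Add (Mul termH (Mul (FnS s t) (FnS s' t')))
    (Add (Mul termP (Add (Mul (FnT s t) (FnS s' t')) (Mul (FnS s t) (FnT s' t'))))
         (Mul termS (Mul (FnT s t) (FnT s' t')))).

(** The functions a, b, m11, m12, m22, v1, v2 whose differentials are the coframe
    up to [correction]. *)
Definition potential (a : 'I_7) : term :=
  match val a with
  | 0%N => Mul t_ (FnS s1 t1)
  | 1%N => Mul t_ (FnS s2 t2)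
  | 2%N => quadratic s1 t1 s1 t1
  | 3%N => quadratic s1 t1 s2 t2
  | 4%N => quadratic s2 t2 s2 t2
  | 5%N => Add (Mul termF (FnT s2 t2)) (Mul termG (FnS s2 t2))
  | _ => Mul (Cst (-1)) (Add (Mul termF (FnT s1 t1)) (Mul termG (FnS s1 t1)))
  end.

(** Multiples of dx that absorb the curvature term - (3 / 2) t^2 y^2 dx^2 of the
    metric. *)
Definition correction (a : 'I_7) : term :=
  match val a with
  | 5%N => Mul (Cst (3 / 2)) (Mul (Mul y_ y_) (Mul t_ (FnS s2 t2)))
  | 6%N => Mul (Cst (- (3 / 2))) (Mul (Mul y_ y_) (Mul t_ (FnS s1 t1)))
  | _ => Cst 0
  end.

Definition coframe a P V : R := tdiff (potential a) P V + teval (correction a) P * V 0 1.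

(** The h_5-valued coefficient of dx in the connection form of the coframe. *)
Definition theta P : 'rV[R]_5 :=
  let a := s1 (P 0 1) in let b := s2 (P 0 1) in let y := P 0 2 in
  \row_i nth 0 [:: y * a ^+ 3; y * a ^+ 2 * b; y * b ^+ 3; - 3 * y * a * b ^+ 2;
                   3 * y ^+ 2] i.

Lemma theta0 P : theta P 0 0 = P 0 2 * s1 (P 0 1) ^+ 3. Proof. by rewrite mxE. Qed.
Lemma theta1 P : theta P 0 1 = P 0 2 * s1 (P 0 1) ^+ 2 * s2 (P 0 1).
Proof. by rewrite mxE. Qed.
Lemma theta2 P : theta P 0 2 = P 0 2 * s2 (P 0 1) ^+ 3. Proof. by rewrite mxE. Qed.
Lemma theta3 P : theta P 0 3 = - 3 * P 0 2 * s1 (P 0 1) * s2 (P 0 1) ^+ 2.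
Proof. by rewrite mxE. Qed.
Lemma theta4 P : theta P 0 4 = 3 * P 0 2 ^+ 2. Proof. by rewrite mxE. Qed.
Definition thetaE := (theta0, theta1, theta2, theta3, theta4).

Section Forms.
Variable P : 'rV[R]_7.
Let x := P 0 1. Let y := P 0 2. Let t := P 0 0.
(** The coframe in terms of 1-forms that no longer involve s1 and s2: since
    s'' = I s / 3, differentiating H si sj + P (si sj)' + S si' sj' gives an
    expression of the same shape with coefficients [formA], [formB], [formC],
    and differentiating F si' + G si gives coefficients [formU] of si' and
    [formV] of si; the last term of [formV] is the correction. *)
Definition formA V := tdiff termH P V + 2 / 3 * I x * teval termP P * V 0 1.
Definition formB V := tdiff termP P V + (teval termH P + I x / 3 * teval termS P) * V 0 1.
Definition formC V := tdiff termS P V + 2 * teval termP P * V 0 1.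
Definition formU V := tdiff termF P V + teval termG P * V 0 1.
Definition formV V := tdiff termG P V + I x / 3 * teval termF P * V 0 1
  + 3 / 2 * y ^+ 2 * t * V 0 1.

Lemma coframe0 V : coframe 0 P V = s1 x * V 0 0 + t * t1 x * V 0 1.
Proof. rewrite /coframe /= -/x -/t; by ring. Qed.
Lemma coframe1 V : coframe 1 P V = s2 x * V 0 0 + t * t2 x * V 0 1.
Proof. rewrite /coframe /= -/x -/t; by ring. Qed.
Let m (s t s' t' : R -> R) V : R := formA V * s x * s' x
  + formB V * (t x * s' x + s x * t' x) + formC V * t x * t' x.
Lemma tdiff_quadratic s t' s' t'' V : tdiff (quadratic s t' s' t'') P V = m s t' s' t'' V.
Proof.
rewrite /m /formA /formB /formC /quadratic.
move: termH termP termS => h p r /=; rewrite -/x; by field.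
Qed.
Lemma coframe2 V : coframe 2 P V = m s1 t1 s1 t1 V.
Proof. by rewrite /coframe [tdiff _ _ _]tdiff_quadratic /= mul0r addr0. Qed.
Lemma coframe3 V : coframe 3 P V = m s1 t1 s2 t2 V.
Proof. by rewrite /coframe [tdiff _ _ _]tdiff_quadratic /= mul0r addr0. Qed.
Lemma coframe4 V : coframe 4 P V = m s2 t2 s2 t2 V.
Proof. by rewrite /coframe [tdiff _ _ _]tdiff_quadratic /= mul0r addr0. Qed.
Lemma coframe5 V : coframe 5 P V = t2 x * formU V + s2 x * formV V.
Proof.
rewrite /coframe /formU /formV /potential /=.
move: termG termF => g f; rewrite -/x -/y -/t; by field.
Qed.
Lemma coframe6 V : coframe 6 P V = - (t1 x * formU V + s1 x * formV V).
Proof.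
rewrite /coframe /formU /formV /potential /=.
move: termG termF => g f; rewrite -/x -/y -/t; by field.
Qed.
End Forms.
Definition coframeE := (coframe0, coframe1, coframe2, coframe3, coframe4, coframe5, coframe6).

Definition eta_form (X Y : 'I_7 -> R) : R :=
  2^-1 * (X 0 * Y 5 + X 5 * Y 0) + 2^-1 * (X 1 * Y 6 + X 6 * Y 1)
  + 4^-1 * (X 2 * Y 4 + X 4 * Y 2) - 2^-1 * (X 3 * Y 3).

Definition wronskian_eq1 P := s1 (P 0 1) * t2 (P 0 1) - t1 (P 0 1) * s2 (P 0 1) = 1.

(** SL_2-invariance of eta: the expression in s1, s2 and their derivatives
    factors through powers of their Wronskian, so they drop out. *)
Lemma eta_coframe P V W : wronskian_eq1 P ->
  eta_form (fun a => coframe a P V) (fun a => coframe a P W) =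
  2^-1 * (V 0 0 * formU P W + W 0 0 * formU P V
    - P 0 0 * (V 0 1 * formV P W + W 0 1 * formV P V))
  + 4^-1 * (formA P V * formC P W + formA P W * formC P V - 2 * formB P V * formB P W).
Proof.
rewrite /wronskian_eq1 /eta_form !coframeE => w1.
set a := formU P V; set a' := formU P W; set b := formV P V; set b' := formV P W.
set A := formA P V; set A' := formA P W; set B := formB P V; set B' := formB P W.
set C := formC P V; set C' := formC P W.
set w := _ - _ in w1.
transitivity (2^-1 * (V 0 0 * a' + W 0 0 * a
    - P 0 0 * (V 0 1 * b' + W 0 1 * b)) * w
  + 4^-1 * (A * C' + A' * C - 2 * B * B') * w ^+ 2).
  by rewrite /w; field.
by rewrite w1 expr1n !mulr1.
Qed.

(** F_I is quadratic in the coordinate q of index 3. *)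
Lemma derive_F_I (u : 'rV[R]_5) : 'D_(unit_vec 3) (F_I I) u = - u 0 3.
Proof.
apply: (@derive_val _ _ _ _ _ _ (- u 0 3)).
pose c : R := F_I I u + 2^-1 * u 0 3 ^+ 2.
have FE h : F_I I (h *: unit_vec 3 + u) = - 2^-1 * (h + u 0 3) ^+ 2 + c.
  by rewrite /c /F_I !mxE /= !mulr0 !add0r mulr1; ring.
apply: is_derive_line; under eq_fun do rewrite FE.
have -> : (fun h => - 2^-1 * (h + u 0 3) ^+ 2 + c) =
  (- 2^-1) *: ((id + cst (u 0 3)) ^+ 2) + cst c :> (R -> R).
  by apply/funext => h; rewrite !fctE.
apply: is_derive_eq; rewrite /= !fctE /GRing.scale /=; by field.
Qed.

(** The metric in the same 1-forms.  Together with [eta_coframe] this says that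
    the coframe has constant Gram matrix; the coefficients 10 / 3 and
    1 + I^2 - I'' of F_I enter here. *)
Lemma gt_I_formE P V W :
  gt_I I P V W =
  2^-1 * (V 0 0 * formU P W + W 0 0 * formU P V
    - P 0 0 * (V 0 1 * formV P W + W 0 1 * formV P V))
  + 4^-1 * (formA P V * formC P W + formA P W * formC P V - 2 * formB P V * formB P W).
Proof.
rewrite /gt_I /g_I /symprod /omega1 /omega2 /omega3 /omega4 /omega5 /dt /drho.
rewrite !derive_F_I /F_I !mxE !midE ord0_7 ord_max_7.
rewrite /formU /formV /formA /formB /formC /=.
by field.
Qed.

Lemma h5_mx_coframe5 P W : wronskian_eq1 P -> \sum_b h5_mx (theta P) 5 b * coframe b P W =
  P 0 2 * s2 (P 0 1) / 2 * formC P W - 3 / 2 * P 0 2 ^+ 2 * coframe 1 P W.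
Proof.
rewrite /wronskian_eq1 => w1; rewrite h5_mx_sum !thetaE coframe2 coframe3 coframe4.
set w := _ - _ in w1; transitivity (P 0 2 * s2 (P 0 1) / 2 * formC P W * w ^+ 2
  - 3 / 2 * P 0 2 ^+ 2 * coframe 1 P W); first by rewrite /w; field.
by rewrite w1 expr1n mulr1.
Qed.

Lemma h5_mx_coframe6 P W : wronskian_eq1 P -> \sum_b h5_mx (theta P) 6 b * coframe b P W =
  - (P 0 2 * s1 (P 0 1) / 2 * formC P W) + 3 / 2 * P 0 2 ^+ 2 * coframe 0 P W.
Proof.
rewrite /wronskian_eq1 => w1; rewrite h5_mx_sum !thetaE coframe2 coframe3 coframe4.
set w := _ - _ in w1; transitivity (- (P 0 2 * s1 (P 0 1) / 2 * formC P W * w ^+ 2)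
  + 3 / 2 * P 0 2 ^+ 2 * coframe 0 P W); first by rewrite /w; field.
by rewrite w1 expr1n mulr1.
Qed.

(** Cartan's first structure equation: the covariant derivative of the coframe
    is symmetric.  The potentials drop out by [thessC].  In the middle rows the
    connection contributes multiples of dx (s1 db - s2 da), which is
    symmetric because s1 db - s2 da = t dx; in the last two rows it balances
    the derivative of the correction. *)
Lemma torsion_free P (a : 'I_7) V W : wronskian_eq1 P ->
  thess (potential a) P V W + tdiff (correction a) P V * W 0 1
    + V 0 1 * \sum_b h5_mx (theta P) a b * coframe b P W
  = thess (potential a) P W V + tdiff (correction a) P W * V 0 1
    + W 0 1 * \sum_b h5_mx (theta P) a b * coframe b P V.
Proof.
move=> w1; rewrite thessC -!addrA; congr (_ + _).
move: a; apply: ord7_ind.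
1,2: by rewrite !h5_mx_sum /=; ring.
1-3: by rewrite !h5_mx_sum !thetaE !coframe0 !coframe1 /=; field.
- by rewrite !h5_mx_coframe5// !coframe1 /formC /=; field.
- by rewrite !h5_mx_coframe6// !coframe0 /formC /=; field.
Qed.

(** The coframe is triangular: da and db determine dt and dx, then dmij determine
    dy, dp and dq in this order, and the last two forms determine d rho and
    dz. *)
Lemma coframe_inj P V : wronskian_eq1 P -> P 0 0 != 0 -> (forall a, coframe a P V = 0) -> V = 0.
Proof.
rewrite /wronskian_eq1; set x := P 0 1; set t := P 0 0 => w1 t0 c0.
have lin (b c : R) : s1 x * b + t1 x * c = 0 -> s2 x * b + t2 x * c = 0 -> b = 0 /\ c = 0.
  move=> e1 e2; split.
    transitivity (t2 x * (s1 x * b + t1 x * c) - t1 x * (s2 x * b + t2 x * c)).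
      by rewrite -[LHS]mulr1 -w1; ring.
    by rewrite e1 e2; ring.
  transitivity (s1 x * (s2 x * b + t2 x * c) - s2 x * (s1 x * b + t1 x * c)).
    by rewrite -[LHS]mulr1 -w1; ring.
  by rewrite e1 e2; ring.
have := c0 0; have := c0 1; rewrite coframe0 coframe1 -/x -/t => e1 e0.
have [V0 tV1] : V 0 0 = 0 /\ t * V 0 1 = 0 by apply: lin; [rewrite -[RHS]e0|rewrite -[RHS]e1]; ring.
have V1 : V 0 1 = 0 by move/eqP: tV1; rewrite mulf_eq0 (negbTE t0) => /eqP.
have := c0 5; have := c0 6; rewrite coframe5 coframe6 -/x => e6 e5.
have [be0 al0] : formV P V = 0 /\ formU P V = 0.
  by apply: lin; [rewrite -[RHS]oppr0 -e6|rewrite -[RHS]e5]; ring.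
have := c0 2; have := c0 3; have := c0 4; rewrite coframe2 coframe3 coframe4 -/x => e4 e3 e2.
set A := formA P V in e2 e3 e4; set B := formB P V in e2 e3 e4; set C := formC P V in e2 e3 e4.
have [u1 v1] : A * s1 x + B * t1 x = 0 /\ B * s1 x + C * t1 x = 0.
  by apply: lin; [rewrite -[RHS]e2|rewrite -[RHS]e3]; ring.
have [u2 v2] : A * s2 x + B * t2 x = 0 /\ B * s2 x + C * t2 x = 0.
  by apply: lin; [rewrite -[RHS]e3|rewrite -[RHS]e4]; ring.
have [A0 B0] : A = 0 /\ B = 0 by apply: lin; [rewrite -[RHS]u1|rewrite -[RHS]u2]; ring.
have [_ C0] : B = 0 /\ C = 0 by apply: lin; [rewrite -[RHS]v1|rewrite -[RHS]v2]; ring.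
have cancel (k b : R) : k != 0 -> k * t * b = 0 -> b = 0.
  by move=> k0 /eqP; rewrite !mulf_eq0 (negbTE k0) (negbTE t0) => /eqP.
have V2 : V 0 2 = 0.
  by apply: (cancel 6) => //; rewrite -[RHS]C0 /C /formC /= V0 V1 -/t; ring.
have V3 : V 0 3 = 0.
  by apply: (cancel (-2)) => //; rewrite ?oppr_eq0// -[RHS]B0 /B /formB /= V0 V1 -/t; ring.
have V4 : V 0 4 = 0.
  by apply: (cancel 1) => //; rewrite -[RHS]A0 /A /formA /= V0 V1 V2 -/t; ring.
have V6 : V 0 6 = 0.
  by apply: (cancel 2) => //; rewrite -[RHS]al0 /formU /= V0 V1 V2 V3 V4 -/t; ring.
have V5 : V 0 5 = 0.
  by apply: (cancel 3) => //; rewrite -[RHS]be0 /formV /= V0 V1 V2 V3 V4 -/t; ring.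
by apply/rowP; apply: ord7_ind; rewrite [RHS]mxE.
Qed.
End Coframe.

(** * The Levi-Civita connection of the ambient metric *)

Section Frame.
Context {R : realType}.
Variables (U : set R) (I s1 t1 s2 t2 : R -> R).
Hypothesis openU : open U.
Hypothesis itvU : is_interval U.
Hypothesis smoothI : smooth_on U I.
Hypothesis sol1 : solution U I s1 t1.
Hypothesis sol2 : solution U I s2 t2.
Hypothesis wronsk : forall x, U x -> s1 x * t2 x - t1 x * s2 x = 1.
Implicit Types (P V W : 'rV[R]_7).
Local Notation potential_ := (potential I s1 t1 s2 t2).
Local Notation correction_ := (correction I s1 t1 s2 t2).
Local Notation coframe_ := (coframe I s1 t1 s2 t2).
Local Notation theta_ := (theta s1 s2).
Local Notation LC := (levi_civita (gt_I I)).

Lemma base_x P : base P 0 0 = P 0 1.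
Proof. by rewrite mxE midE. Qed.

Lemma open_Mt_I : open (Mt_I U).
Proof.
rewrite openE => P [t0 xU].
have c0 : {for P, continuous (fun Q : 'rV[R]_7 => Q 0 ord0)} by apply: coord_continuous.
have c1 : {for P, continuous (fun Q : 'rV[R]_7 => Q 0 1)} by apply: coord_continuous.
rewrite /M_I /= base_x in xU.
have n0 : nbhs P (fun Q : 'rV[R]_7 => 0 < Q 0 ord0) by exact: (c0 _ (lt_nbhsr t0)).
have n1 : nbhs P (fun Q : 'rV[R]_7 => U (Q 0 1)) by apply: c1; exact: openU.
near=> Q; split; first by near: Q.
by rewrite /M_I /= base_x; near: Q.
Unshelve. all: by end_near. Qed.

Definition coframe_mx P : 'M[R]_7 := \matrix_(a, j) coframe_ a P (unit_vec j).

Lemma coframe_mxE P V a : (coframe_mx P *m V^T) a 0 = coframe_ a P V.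
Proof.
rewrite mxE /coframe tdiffE; under eq_bigr do rewrite 2!mxE /coframe.
have -> : \sum_j (tdiff (potential_ a) P (unit_vec j) + teval (correction_ a) P * unit_vec j 0 1) * V 0 j
  = \sum_j V 0 j * tdiff (potential_ a) P (unit_vec j)
    + \sum_j teval (correction_ a) P * (unit_vec j 0 1 * V 0 j).
  by rewrite -big_split; apply: eq_bigr => j _ /=; ring.
congr (_ + _); rewrite -mulr_sumr (bigD1 1) //= !mxE !eqxx mul1r big1 ?addr0// => j j1.
by rewrite !mxE eqxx eq_sym (negbTE j1) mul0r.
Qed.

Lemma Mt_wronskian P : Mt_I U P -> wronskian_eq1 s1 t1 s2 t2 P.
Proof. by move=> [_]; rewrite /M_I /= base_x => /wronsk. Qed.

Lemma coframe_mx_unit P : Mt_I U P -> coframe_mx P \in unitmx.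
Proof.
move=> MP; rewrite -unitmx_tr -row_free_unit -kermx_eq0; apply/rowV0P => v.
move=> /sub_kermxP vE; apply: (@coframe_inj _ I s1 t1 s2 t2 P); first exact: Mt_wronskian.
  by case: MP => t0 _; rewrite -ord0_7 gt_eqF.
by move=> a; rewrite -coframe_mxE -[_ *m _]trmxK trmx_mul !trmxK vE !mxE.
Qed.

Definition eta : 'M[R]_7 := \matrix_(i, j)
  match nat_of_ord i, nat_of_ord j with
  | 0%N, 5%N | 5%N, 0%N | 1%N, 6%N | 6%N, 1%N => 2^-1
  | 2%N, 4%N | 4%N, 2%N => 4^-1
  | 3%N, 3%N => - 2^-1
  | _, _ => 0
  end.

Lemma eta_sum a (c : 'I_7 -> R) :
  \sum_b eta a b * c b = nth 0 [:: c 5 / 2; c 6 / 2; c 4 / 4; - c 3 / 2; c 2 / 4; c 0 / 2;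
      c 1 / 2] a.
Proof. by move: a; apply: ord7_ind; rewrite sum_ord7 !mxE /=; field. Qed.

Lemma eta_sym : eta^T = eta.
Proof.
by apply/matrixP; apply: ord7_ind; apply: ord7_ind; rewrite !mxE.
Qed.

Lemma eta_unit : eta \in unitmx.
Proof.
rewrite -row_free_unit -kermx_eq0; apply/rowV0P => v /sub_kermxP vE.
have H a : \sum_b eta a b * v 0 b = 0.
  transitivity ((v *m eta) 0 a); last by rewrite vE mxE.
  by rewrite mxE; apply: eq_bigr => b _; rewrite -[in LHS]eta_sym mxE mulrC.
apply/rowP; apply: ord7_ind; rewrite [RHS]mxE.
- by have := H 5; rewrite eta_sum /= => h; lra.
- by have := H 6; rewrite eta_sum /= => h; lra.
- by have := H 4; rewrite eta_sum /= => h; lra.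
- by have := H 3; rewrite eta_sum /= => h; lra.
- by have := H 2; rewrite eta_sum /= => h; lra.
- by have := H 0; rewrite eta_sum /= => h; lra.
- by have := H 1; rewrite eta_sum /= => h; lra.
Qed.

Lemma eta_h5_skew x : (eta *m h5_mx x)^T = - (eta *m h5_mx x).
Proof.
have e a b : (eta *m h5_mx x) a b = nth 0 [:: h5_mx x 5 b / 2; h5_mx x 6 b / 2;
    h5_mx x 4 b / 4; - h5_mx x 3 b / 2; h5_mx x 2 b / 4; h5_mx x 0 b / 2; h5_mx x 1 b / 2] a.
  by rewrite mxE (eta_sum a (fun c => h5_mx x c b)).
apply/matrixP => i j; rewrite mxE [RHS]mxE !e.
by move: i j; apply: ord7_ind; apply: ord7_ind => /=; rewrite !mxE /=; field.
Qed.

Lemma gram_coframe P : Mt_I U P -> gram (gt_I I) P = (coframe_mx P)^T *m eta *m coframe_mx P.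
Proof.
move=> MP; apply/matrixP => j l; rewrite mxE gt_I_formE -(eta_coframe _ _ _ (Mt_wronskian MP)).
rewrite -mulmxA mxE.
under eq_bigr => a _ do rewrite mxE [X in _ * X]mxE (eta_sum a (fun b => coframe_mx P b l)).
by rewrite sum_ord7 /= !mxE /eta_form; field.
Qed.

Lemma is_derive_I k x : U x -> is_derive x (1 : R) (I^`(k))%classic ((I^`(k.+1))%classic x).
Proof.
by move=> Ux; rewrite derive1nS derive1E; apply: derivableP; exact: smoothI.
Qed.

Lemma wf_I k : wf_term U (Fn (I^`(k))%classic (I^`(k.+1))%classic (I^`(k.+2))%classic).
Proof. by constructor => x; exact: is_derive_I. Qed.

Lemma wf_S s t : solution U I s t -> wf_term U (Fn s t (fun x => I x * s x / 3)).
Proof. by move=> st; constructor => x /st[]. Qed.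

Lemma wf_T s t : solution U I s t ->
  wf_term U (Fn t (fun x => I x * s x / 3) (fun x => ((I^`(1))%classic x * s x + I x * t x) / 3)).
Proof.
move=> st; constructor => x Ux; have [ds dt] := st _ Ux => //.
have dI := is_derive_I 0 Ux.
have := is_derive_mulE (is_derive_mulE dI ds) (is_derive_cst (3^-1 : R) x 1).
by rewrite mulr0 addr0.
Qed.

(** The leaves are selected by their function and not by unification, which
    would try to unfold iterated derivatives. *)
Ltac prove_wf leaf :=
  lazymatch goal with |- wf_term _ ?e =>
    let e' := eval hnf in e in
    lazymatch e' with
    | Var _ => exact: WfVar
    | Cst _ => exact: WfCst
    | Add ?a ?b => apply: (@WfAdd _ _ a b); prove_wf leaf
    | Mul ?a ?b => apply: (@WfMul _ _ a b); prove_wf leaf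
    | Fn ?f _ _ => leaf f
    end
  end.

Lemma wf_potential a : wf_term U (potential_ a).
Proof.
have wI := wf_I 0; have wI1 := wf_I 1.
have wS1 := wf_S sol1; have wS2 := wf_S sol2.
have wT1 := wf_T sol1; have wT2 := wf_T sol2.
move: a; apply: ord7_ind; prove_wf ltac:(fun f => first
 [constr_eq f s1; exact: wS1 | constr_eq f s2; exact: wS2
 |constr_eq f t1; exact: wT1 | constr_eq f t2; exact: wT2
 |constr_eq f I; exact: wI | exact: wI1]).
Qed.

Lemma wf_correction a : wf_term U (correction_ a).
Proof.
have wS1 := wf_S sol1; have wS2 := wf_S sol2.
move: a; apply: ord7_ind; prove_wf ltac:(fun f => first
 [constr_eq f s1; exact: wS1 | exact: wS2]).
Qed.

Definition dcoframe P (w : 'rV[R]_7) : 'M[R]_7 :=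
  \matrix_(a, j) (thess (potential_ a) P w (unit_vec j) + tdiff (correction_ a) P w * unit_vec j 0 1).

Lemma is_derive_coframe_mx (g : R -> 'rV[R]_7) (s : R) (w : 'rV[R]_7) :
  (forall i, is_derive s (1 : R) (fun r => g r 0 i) (w 0 i)) -> Mt_I U (g s) ->
  forall a j, is_derive s (1 : R) (fun r => coframe_mx (g r) a j) (dcoframe (g s) w a j).
Proof.
move=> dg [_]; rewrite /M_I /= base_x => gU a j.
have -> : (fun r => coframe_mx (g r) a j) = fun r => coframe_ a (g r) (unit_vec j).
  by apply/funext => r; rewrite mxE.
rewrite [X in is_derive _ _ _ X]mxE.
have := is_derive_tdiff dg gU (unit_vec j) (wf_potential a).
have := is_derive_teval dg gU (wf_correction a) => ? ?.
apply: is_deriveD.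
rewrite -[X in is_derive _ _ _ X]addr0 -[X in _ + X](mulr0 (teval (correction_ a) (g s))).
exact: is_derive_mulE.
Qed.

Lemma dcoframe_sum P w : dcoframe P w = \sum_i w 0 i *: dcoframe P (unit_vec i).
Proof.
apply/matrixP => a j; rewrite summxE !mxE thessE tdiffE mulr_suml -big_split.
by apply: eq_bigr => i _; rewrite !mxE /=; ring.
Qed.

Lemma levi_civita_gt P i : Mt_I U P ->
  levi_civita (gt_I I) P i =
  invmx (coframe_mx P) *m (dcoframe P (unit_vec i) + (unit_vec i 0 1 *: h5_mx (theta_ P)) *m
      coframe_mx P).
Proof.
move=> MP.
move: i; apply: (@levi_civita_frame R 7 (gt_I I) P coframe_mx eta (fun i => dcoframe P (unit_vec i))
  (fun i => unit_vec i 0 1 *: h5_mx (theta_ P))); [exact: eta_sym|exact: eta_unit| | | | |].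
- exact: coframe_mx_unit MP.
- have : nbhs P (Mt_I U) by exact: open_Mt_I.
  by apply: filterS => Q; exact: gram_coframe.
- move=> i a j; apply: is_derive_line.
  have := @is_derive_coframe_mx (fun h => h *: unit_vec i + P) 0 (unit_vec i).
  rewrite scale0r add0r; apply => // k.
  by under eq_fun do rewrite addrC; exact: (is_derive_line_coord P (unit_vec i)).
- by move=> i; rewrite -scalemxAr linearZ /= eta_h5_skew scalerN.
- move=> i j a; rewrite -!scalemxAl.
  have S k l : (unit_vec k 0 1 *: (h5_mx (theta_ P) *m coframe_mx P)) a l =
      unit_vec k 0 1 * \sum_b h5_mx (theta_ P) a b * coframe_ b P (unit_vec l).
    rewrite mxE; congr (_ * _); rewrite mxE; apply: eq_bigr => b _.
    by congr (_ * _); rewrite mxE.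
  rewrite mxE S [RHS]mxE S [X in X + _ = _]mxE [X in _ = X + _]mxE.
  exact: (torsion_free I a (unit_vec i) (unit_vec j) (Mt_wronskian MP)).
Qed.

(** Along a curve with velocity w, the connection matrix of the coordinate frame,
    read in the coframe, is the derivative of the coframe plus the connection
    form evaluated on w. *)
Lemma levi_civita_curve P (w : 'rV[R]_7) : Mt_I U P ->
  coframe_mx P *m (\sum_i w 0 i *: levi_civita (gt_I I) P i) =
  dcoframe P w + w 0 1 *: (h5_mx (theta_ P) *m coframe_mx P).
Proof.
move=> MP; rewrite dcoframe_sum mulmx_sumr.
have e i : coframe_mx P *m (w 0 i *: levi_civita (gt_I I) P i) = w 0 i *: dcoframe P (unit_vec i)
    + (w 0 i * unit_vec i 0 1) *: (h5_mx (theta_ P) *m coframe_mx P).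
  rewrite levi_civita_gt// -scalemxAr mulmxA mulmxV; last exact: coframe_mx_unit MP.
  by rewrite mul1mx scalerDr -scalemxAl scalerA.
under eq_bigr do rewrite e.
rewrite big_split; congr (_ + _) => /=.
rewrite -scaler_suml; congr (_ *: _).
rewrite (bigD1 1) //= !mxE !eqxx mulr1 big1 ?addr0// => j j1.
by rewrite !mxE eqxx eq_sym (negbTE j1) mulr0.
Qed.

(** * Transport along an arc by quadratures *)

Section ArcHolonomy.
Variable g : R -> 'rV[R]_7.
Hypothesis smooth_g : smooth_arc (Mt_I U) g.

Let w s : 'rV[R]_7 := \row_i (fun r => g r 0 i)^`()%classic s.
(** In the coframe, parallel transport along g is Q' = h5_mx (zeta) Q. *)
Definition zeta s : 'rV[R]_5 := - (fun r => g r 0 1)^`()%classic s *: theta_ (g s).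

Lemma arc_derive s i : is_derive s (1 : R) (fun r => g r 0 i) (w s 0 i).
Proof.
have [sg _] := smooth_g.
by rewrite mxE derive1E; apply: derivableP; exact: (sg i 0%N s).
Qed.

Let gM s : 0 <= s <= 1 -> Mt_I U (g s).
Proof. by have [_] := smooth_g; exact. Qed.

Let Eunit s : 0 <= s <= 1 -> coframe_mx (g s) \in unitmx.
Proof. by move=> s01; exact: (coframe_mx_unit (gM s01)). Qed.

Let A s := \sum_i (fun r => g r 0 i)^`()%classic s *: LC (g s) i.

Lemma gauge_coef s : 0 <= s <= 1 ->
  dcoframe (g s) (w s) = coframe_mx (g s) *m A s + h5_mx (zeta s) *m coframe_mx (g s).
Proof.
move=> s01.
have := levi_civita_curve (w s) (gM s01).
have -> : \sum_i w s 0 i *: LC (g s) i = A s by apply: eq_bigr => i _; rewrite mxE.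
move=> ->; rewrite /zeta h5_mxZ -scalemxAl mxE scaleNr.
by rewrite addrK.
Qed.

Lemma gauge_to m (P : R -> 'M[R]_(7, m)) s : 0 <= s <= 1 -> mderiv P s (- A s *m P s) ->
  mderiv (fun r => coframe_mx (g r) *m P r) s (h5_mx (zeta s) *m (coframe_mx (g s) *m P s)).
Proof.
move=> s01 dP.
have dEs : mderiv (fun r => coframe_mx (g r)) s (dcoframe (g s) (w s)).
  exact: (is_derive_coframe_mx (arc_derive s) (gM s01)).
have := mderivM dEs dP; congr mderiv.
by rewrite gauge_coef// mulmxDl mulNmx mulmxN !mulmxA addrAC subrr add0r.
Qed.

Lemma gauge_from m (Q : R -> 'M[R]_(7, m)) s : 0 <= s <= 1 ->
  mderiv Q s (h5_mx (zeta s) *m Q s) ->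
  mderiv (fun r => invmx (coframe_mx (g r)) *m Q r) s (- A s *m (invmx (coframe_mx (g s)) *m Q s)).
Proof.
move=> s01 dQ; have Eu := Eunit s01.
have dEs : mderiv (fun r => coframe_mx (g r)) s (dcoframe (g s) (w s)).
  exact: (is_derive_coframe_mx (arc_derive s) (gM s01)).
have := mderivM (mderiv_inv Eu dEs) dQ; congr mderiv.
rewrite gauge_coef// mulmxDr mulKmx// mulmxDl opprD mulmxDl !mulNmx !mulmxA.
by rewrite (mulmxK Eu) addrNK.
Qed.

(** If xi' + [xi, xi'] / 2 = zeta then exp (xi) solves the transport equation in
    the coframe.  The bracket is central, so it may be computed with zeta in
    place of xi', which makes the equation for xi explicit. *)
Lemma arc_solve (xi : R -> 'rV[R]_5) : xi 0 = 0 ->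
  (forall s : R, 0 <= s <= 1 -> mderiv xi s (zeta s - 2^-1 *: h5_bracket (xi s) (zeta s))) ->
  forall C, arc_transport LC g C <-> C = invmx (coframe_mx (g 1)) *m H5_exp (xi 1) *m
      coframe_mx (g 0).
Proof.
move=> xi0 dxi C.
have l01 : 0 <= (0 : R) <= 1 by rewrite lexx ler01.
have r01 : 0 <= (1 : R) <= 1 by rewrite lexx ler01.
have dY s : 0 <= s <= 1 -> mderiv (fun r => H5_exp (xi r)) s (h5_mx (zeta s) *m H5_exp (xi s)).
  move=> s01; have := mderiv_H5_exp (dxi s s01); congr (mderiv _ _ (h5_mx _ *m _)).
  suff -> : h5_bracket (xi s) (zeta s - 2^-1 *: h5_bracket (xi s) (zeta s)) =
    h5_bracket (xi s) (zeta s) by rewrite subrK.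
  by apply/rowP => i; rewrite /h5_bracket /unit_vec !mxE /=; ring.
rewrite arc_transportE; split=> [[P [P0 P1 dP]]|->].
  have := @mderiv_unique _ _ _ (fun s => h5_mx (zeta s)) (fun s => H5_exp (xi s))
    (fun s => coframe_mx (g s) *m P s) _ 0 1 is_interval01 (fun s _ => H5_exp_unit (xi s)) dY
    (fun s s01 => gauge_to s01 (dP s s01)) l01 r01.
  rewrite xi0 H5_exp0 invmx1 mul1mx P0 mulmx1 P1 => ->.
  by rewrite -mulmxA mulKVmx ?H5_exp_unit// mulKmx// Eunit.
exists (fun s => invmx (coframe_mx (g s)) *m (H5_exp (xi s) *m coframe_mx (g 0))); split.
- by rewrite xi0 H5_exp0 mul1mx mulVmx// Eunit.
- by rewrite mulmxA.
- move=> s s01; apply: gauge_from => //.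
  have := mderivM (dY s s01) (mderiv_cst (coframe_mx (g 0)) s).
  by rewrite mulmx0 addr0 mulmxA.
Qed.

Lemma continuous_theta (s : R) k : 0 <= s <= 1 -> {for s, continuous (fun r => theta_ (g r) 0 k)}.
Proof.
move=> s01; have dg i := arc_derive s i.
have Ux : U (g s 0 1) by have [_] := gM s01; rewrite /M_I /= base_x.
have cy : {for s, continuous (fun r => g r 0 2)} by exact: is_derive_continuous (dg 2).
have ca : {for s, continuous (fun r => s1 (g r 0 1))}.
  apply: (@continuous_comp _ _ _ (fun r => g r 0 1) s1); first exact: is_derive_continuous (dg 1).
  by have [d _] := sol1 Ux; exact: is_derive_continuous d.
have cb : {for s, continuous (fun r => s2 (g r 0 1))}.
  apply: (@continuous_comp _ _ _ (fun r => g r 0 1) s2); first exact: is_derive_continuous (dg 1).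
  by have [d _] := sol2 Ux; exact: is_derive_continuous d.
have ext (u v : R -> R) : u =1 v -> {for s, continuous u} -> {for s, continuous v}.
  by move=> /funext ->.
pose y r := g r 0 2; pose a r := s1 (g r 0 1); pose b r := s2 (g r 0 1).
have cc (c : R) : {for s, continuous (fun _ : R => c)} by exact: for_continuous_cst.
move: k; apply: ord5_ind.
- apply: (ext (fun r => y r * a r ^+ 3)) => [r|]; first by rewrite mxE.
  by apply: for_continuousM => //; exact: for_continuousX.
- apply: (ext (fun r => y r * a r ^+ 2 * b r)) => [r|]; first by rewrite mxE.
  by apply: for_continuousM => //; apply: for_continuousM => //; exact: for_continuousX.
- apply: (ext (fun r => y r * b r ^+ 3)) => [r|]; first by rewrite mxE.
  by apply: for_continuousM => //; exact: for_continuousX.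
- apply: (ext (fun r => - 3 * y r * a r * b r ^+ 2)) => [r|]; first by rewrite mxE.
  by apply: for_continuousM;
    [apply: for_continuousM => //; apply: for_continuousM|exact: for_continuousX].
- apply: (ext (fun r => 3 * y r ^+ 2)) => [r|]; first by rewrite mxE.
  by apply: for_continuousM => //; exact: for_continuousX.
Qed.

Lemma continuous_zeta (s : R) k : 0 <= s <= 1 -> {for s, continuous (fun r => zeta r 0 k)}.
Proof.
move=> s01.
have -> : (fun r => zeta r 0 k) = fun r => - (fun r => g r 0 1)^`()%classic r * theta_ (g r) 0 k.
  by apply/funext => r; rewrite mxE.
apply: continuousM; last exact: continuous_theta.
apply: continuousN; have [sg _] := smooth_g.
by have := sg 1 1%N s Logic.I; rewrite derive1n1 => /derivable1_diffP;
    exact: differentiable_continuous.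
Qed.

(** Modulo the centre, xi is any primitive X of zeta; only the central component
    is coupled to the other ones. *)
Lemma arc_xi (X : 'I_5 -> R -> R) :
  (forall k : 'I_5, k != 4 -> X k 0 = 0 /\ forall s : R, 0 <= s <= 1 -> is_derive s (1 :
      R) (X k) (zeta s 0 k)) ->
  exists c, forall C, arc_transport LC g C <->
    C = invmx (coframe_mx (g 1)) *m H5_exp (\row_k (if k == 4 then c else X k 1)) *m
        coframe_mx (g 0).
Proof.
move=> HX.
pose om s := X 0 s * zeta s 0 2 - X 2 s * zeta s 0 0 + (X 1 s * zeta s 0 3 - X 3 s * zeta s 0 1).
have [|X4 [X40 dX4]] := @antiderivative01 _ (fun s => zeta s 0 4 - 2^-1 * om s).
  move=> s s01; have cz k : {for s, continuous (fun r => zeta r 0 k)} by exact: continuous_zeta.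
  have cX (k : 'I_5) : k != 4 -> {for s, continuous (X k)}.
    by move=> /HX[_ /(_ s s01)]; exact: is_derive_continuous.
  apply: continuousB; first exact: cz.
  apply: continuousM; first exact: cvg_cst.
  by apply: continuousD; apply: continuousB; apply: continuousM; first [exact: cz|exact: cX].
exists (X4 1) => C.
pose xi s : 'rV[R]_5 := \row_k (if k == 4 then X4 s else X k s).
have xi0 : xi 0 = 0.
  by apply/rowP => k; rewrite !mxE; case: eqVneq => // k4; have [] := HX k k4.
apply: (arc_solve xi0) => s s01 i k; rewrite ord1.
have -> : (zeta s - 2^-1 *: h5_bracket (xi s) (zeta s)) 0 k =
   if k == 4 then zeta s 0 4 - 2^-1 * om s else zeta s 0 k.
  have gen (a b : 'rV[R]_5) : (b - 2^-1 *: h5_bracket a b) 0 k = if k == 4 then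
    b 0 4 - 2^-1 * (a 0 0 * b 0 2 - a 0 2 * b 0 0 + (a 0 1 * b 0 3 - a 0 3 * b 0 1))
    else b 0 k.
    rewrite /h5_bracket /unit_vec !mxE /=.
    by case: eqVneq => [->|_] /=; rewrite ?mulr1 ?mulr0 ?subr0.
  have xiE k' : k' != 4 -> xi s 0 k' = X k' s by move=> k4; rewrite mxE (negbTE k4).
  by rewrite gen !xiE.
have -> : (fun r => xi r 0 k) = if k == 4 then X4 else X k.
  by apply/funext => r; rewrite mxE; case: ifP.
by case: eqVneq => [_|k4]; [exact: dX4|have [_] := HX k k4; exact].
Qed.

Lemma arc_exists : exists x, forall C, arc_transport LC g C <->
  C = invmx (coframe_mx (g 1)) *m H5_exp x *m coframe_mx (g 0).
Proof.
have /choice[X HX] : forall k : 'I_5, exists F : R -> R, F 0 = 0 /\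
    forall s : R, 0 <= s <= 1 -> is_derive s (1 : R) F (zeta s 0 k).
  by move=> k; apply: antiderivative01 => s; exact: continuous_zeta.
by have [|c cP] := @arc_xi X; [move=> k _; exact: HX|eexists; exact: cP].
Qed.

End ArcHolonomy.

(** * Holonomy of a connection pulled back from the ambient space *)

Section Model.
Variables (n : nat) (D : set 'rV[R]_n) (A : @connection R n 7).
Variables (iota : 'rV[R]_n -> 'rV[R]_7) (vx vy : 'rV[R]_n).
(** A is the pullback of the Levi-Civita connection along iota, and D the
    preimage of its domain; iota is affine in the directions vx and vy, which
    it maps to the coordinate directions x and y. *)
Hypothesis arcA : forall (g : R -> 'rV[R]_n) C, (forall i, smooth_on setT (fun s => g s 0 i)) ->
  arc_transport A g C <-> arc_transport LC (iota \o g) C.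
Hypothesis arcD : forall g, smooth_arc D g -> smooth_arc (Mt_I U) (iota \o g).
Hypothesis DE : forall u, D u <-> Mt_I U (iota u).
Hypothesis iota_lin : forall u a b,
  iota (u + (a *: vx + b *: vy)) = iota u + (a *: unit_vec 1 + b *: unit_vec 2).

Let E u := coframe_mx (iota u).
(** The map from the fiber at u to the fiber at v which is exp (x) in the
    coframe. *)
Definition conj_exp u v x : 'M[R]_7 := invmx (E v) *m H5_exp x *m E u.

Lemma frame_unit u : D u -> E u \in unitmx.
Proof. by move=> /DE /coframe_mx_unit. Qed.

Lemma conj_exp_unit u v x : D u -> D v -> conj_exp u v x \in unitmx.
Proof. by move=> Du Dv; rewrite !unitmx_mul unitmx_inv !frame_unit// H5_exp_unit. Qed.

Lemma conj_expM u v w x y : D v -> conj_exp v w y *m conj_exp u v x = conj_exp u w (H5_mul y x).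
Proof.
move=> Dv; rewrite /conj_exp H5_expM -!mulmxA; congr (_ *m (_ *m _)).
by rewrite mulKVmx ?frame_unit.
Qed.

Lemma conj_exp0 u : D u -> conj_exp u u 0 = 1%:M.
Proof. by move=> Du; rewrite /conj_exp H5_exp0 mulmx1 mulVmx ?frame_unit. Qed.

Lemma invmx_conj_exp u v x : D u -> D v -> invmx (conj_exp u v x) = conj_exp v u (- x).
Proof.
move=> Du Dv.
rewrite -[RHS](mulmxK (conj_exp_unit x Du Dv)) conj_expM// H5_mulNx conj_exp0//.
by rewrite mul1mx.
Qed.

Lemma transport_conj_exp p q B : transport D A p q B ->
  D q /\ exists x, B = conj_exp p q x.
Proof.
elim=> [Dp|g B0 C _ [Dg [x ->]] sg aC].
  by split => //; exists 0; rewrite conj_exp0.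
have Dg1 : D (g 1) by have [_] := sg; apply; rewrite ler01 lexx.
split => //.
have [y yP] := arc_exists (arcD sg).
have /yP -> : arc_transport LC (iota \o g) C by apply/arcA => //; have [] := sg.
by exists (H5_mul y x); rewrite -(conj_expM p (g 1) x y Dg).
Qed.

Definition realized u v x := rev_transport D A u v (conj_exp u v x).

Lemma realizedM u v w x y : D v -> realized u v x -> realized v w y -> realized u w (H5_mul y x).
Proof. by move=> Dv ux vy'; rewrite /realized -(conj_expM u w x y Dv);
    exact: rev_transport_comp vy'. Qed.

Lemma realizedN u v x : D u -> D v -> realized u v x -> realized v u (- x).
Proof. by move=> Du Dv /rev_transport_sym; rewrite invmx_conj_exp. Qed.

(** The components of the connection form modulo the centre, divided by y. *)
Definition cubic (k : 'I_5) (x : R) : R :=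
  nth 0 [:: s1 x ^+ 3; s1 x ^+ 2 * s2 x; s2 x ^+ 3; - 3 * s1 x * s2 x ^+ 2] k.

Lemma theta_cubic P (k : 'I_5) : k != 4 -> theta_ P 0 k = P 0 2 * cubic k (P 0 1).
Proof.
by move: k; apply: ord5_ind => // _; rewrite mxE /cubic /=; ring.
Qed.

(** The central component is left existential: it is the one that commutators
    of loops adjust afterwards. *)
Lemma realized_line u a b (X : 'I_5 -> R -> R) :
  (forall s, 0 <= s <= 1 -> D (line u (a *: vx + b *: vy) s)) ->
  (forall k : 'I_5, k != 4 -> X k 0 = 0 /\ forall s : R, 0 <= s <= 1 -> is_derive s (1 : R) (X k)
     (- a * ((iota u 0 2 + s * b) * cubic k (iota u 0 1 + s * a)))) ->
  exists x, realized u (u + (a *: vx + b *: vy)) x /\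
    forall k : 'I_5, k != 4 -> x 0 k = X k 1.
Proof.
set v := a *: vx + b *: vy => Dl HX.
have sl : smooth_arc D (line u v) by split => // i; exact: smooth_line.
have iE s : iota (line u v s) = iota u + ((s * a) *: unit_vec 1 + (s * b) *: unit_vec 2).
  by rewrite /line /v scalerDr !scalerA iota_lin.
have i1 s : iota (line u v s) 0 1 = iota u 0 1 + s * a.
  by rewrite iE !mxE /= mulr1 mulr0 addr0.
have i2 s : iota (line u v s) 0 2 = iota u 0 2 + s * b.
  by rewrite iE !mxE /= mulr1 mulr0 add0r.
have di1 (s : R) : is_derive s (1 : R) (fun r => iota (line u v r) 0 1) a.
  have -> : (fun r => iota (line u v r) 0 1) = fun r => iota u 0 1 + r * a.
    by apply/funext => r; exact: i1.
  exact: is_derive_affine.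
have [k k4|c cP] := arc_xi (arcD sl) (X := X).
  have [X0 dX] := HX k k4; split => // s s01; have := dX s s01.
  have -> // : - a * ((iota u 0 2 + s * b) * cubic k (iota u 0 1 + s * a)) =
     zeta (iota \o line u v) s 0 k.
  rewrite /zeta mxE derive1E; have [_ ->] := di1 s.
  by rewrite theta_cubic//= i1 i2.
pose x : 'rV[R]_5 := \row_k (if k == 4 then c else X k 1).
exists x; split; last by move=> k k4; rewrite mxE (negbTE k4).
have l0 : line u v 0 = u by rewrite /line scale0r addr0.
have l1 : line u v 1 = u + v by rewrite /line scale1r.
have Du : D u by rewrite -l0; apply: Dl; rewrite lexx ler01.
have Duv : D (u + v) by rewrite -l1; apply: Dl; rewrite lexx ler01.
apply: rev_transport_line => //; last exact: conj_exp_unit.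
have sli i : smooth_on setT (fun s => line u v s 0 i) by exact: smooth_line.
have [_] := arcA (conj_exp u (u + v) x) sli; apply.
by apply/cP; rewrite /= l0 l1.
Qed.

Lemma D_translate u a b : D u -> U (iota u 0 1 + a) -> D (u + (a *: vx + b *: vy)).
Proof.
move=> /DE[t0 _] Ua; apply/DE; rewrite iota_lin; split.
  by rewrite !mxE /= !mulr0 !addr0.
by rewrite /M_I /= base_x !mxE /= mulr1 mulr0 addr0.
Qed.

Lemma realized_y_line u b : D u -> exists x, realized u (u + (0 *: vx + b *: vy)) x /\
    forall k : 'I_5, k != 4 -> x 0 k = 0.
Proof.
move=> Du; have /DE[_] := Du; rewrite /M_I /= base_x => Uu.
have [s _|k k4|x xP] := @realized_line u 0 b (fun _ _ => 0); last by exists x.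
  have -> : line u (0 *: vx + b *: vy) s = u + (0 *: vx + (s * b) *: vy).
    by rewrite /line !scale0r !add0r scalerA.
  by apply: D_translate => //; rewrite addr0.
by split => // s _; rewrite oppr0 mul0r; exact: is_derive_cst.
Qed.

Variable K : 'I_5 -> R -> R.
Hypothesis dK : forall k x, U x -> is_derive x (1 : R) (K k) (cubic k x).

Lemma realized_x_line u a : D u -> U (iota u 0 1 + a) ->
  exists x, realized u (u + (a *: vx + 0 *: vy)) x /\
    forall k : 'I_5, k != 4 ->
      x 0 k = - iota u 0 2 * (K k (iota u 0 1 + a) - K k (iota u 0 1)).
Proof.
move=> Du Ua; have /DE[_] := Du; rewrite /M_I /= base_x => Uu.
set x0 := iota u 0 1 in Ua Uu *; set y0 := iota u 0 2.
have Us s : 0 <= s <= 1 -> U (x0 + s * a).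
  move=> /andP[s0 s1']; have [a0|/ltW a0] := leP 0 a.
    apply: (itvU Uu Ua); rewrite lerDl mulr_ge0//= lerD2l.
    by rewrite ler_piMl.
  apply: (itvU Ua Uu); rewrite gerDl mulr_ge0_le0// andbT lerD2l.
  by rewrite ler_niMl.
have [s s01|k k4|x [xr xE]] := @realized_line u a 0
    (fun k s => - y0 * (K k (x0 + s * a) - K k x0)).
- have -> : line u (a *: vx + 0 *: vy) s = u + ((s * a) *: vx + 0 *: vy).
    by rewrite /line !scale0r !addr0 scalerA.
  by apply: D_translate => //; exact: Us.
- split; first by rewrite mul0r addr0 subrr mulr0.
  move=> s s01.
  have dl := is_derive_affine x0 a s.
  have d1 := @is_derive1_comp _ (K k) (fun r => x0 + r * a) s _ _ (dK k (Us s s01)) dl.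
  have -> : - a * ((iota u 0 2 + s * 0) * cubic k (iota u 0 1 + s * a)) =
     - y0 * (cubic k (x0 + s * a) * a - 0) by rewrite -/x0 -/y0; ring.
  apply: is_deriveZ; apply: is_deriveB.
- by exists x; split => // k k4; rewrite xE// mul1r.
Qed.

Lemma H5_mulE (x y : 'rV[R]_5) (k : 'I_5) : k != 4 -> H5_mul x y 0 k = x 0 k + y 0 k.
Proof.
by move=> k4; rewrite /H5_mul /h5_bracket /unit_vec !mxE /= (negbTE k4) !mulr0 addr0.
Qed.

(** The two moves in the x-direction happen at heights y + b and y.  Since the
    connection form is linear in y modulo the centre, their difference depends
    on b alone. *)
Lemma realized_rectangle p a b : D p -> U (iota p 0 1 + a) ->
  exists x, realized p p x /\ forall k : 'I_5, k != 4 ->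
    x 0 k = - b * (K k (iota p 0 1 + a) - K k (iota p 0 1)).
Proof.
move=> Dp Ua; have /DE[_] := Dp; rewrite /M_I /= base_x => Up.
have U0 : U (iota p 0 1 + 0) by rewrite addr0.
have [x1 [r1 e1]] := realized_y_line b Dp.
set p1 := p + _ in r1.
have D1 : D p1 by exact: D_translate.
have i1 : iota p1 0 1 = iota p 0 1 by rewrite iota_lin !mxE /= !(mul0r, mulr0) !addr0.
have i1' : iota p1 0 2 = iota p 0 2 + b by rewrite iota_lin !mxE /= !(mul0r, mulr0, mulr1) !add0r.
have U1 : U (iota p1 0 1 + a) by rewrite i1.
have [x2 [r2 e2]] := realized_x_line D1 U1.
have [x3 [r3 e3]] := realized_x_line Dp Ua.
set p3 := p + _ in r3.
have D3 : D p3 by exact: D_translate.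
have [x4 [r4 e4]] := realized_y_line b D3.
have p2E : p3 + (0 *: vx + b *: vy) = p1 + (a *: vx + 0 *: vy).
  by rewrite /p3 /p1 !scale0r !addr0 !add0r addrAC.
rewrite p2E in r4.
set p2 := p1 + _ in r2 r4.
have D2 : D p2 by exact: D_translate.
exists (H5_mul (- x3) (H5_mul (- x4) (H5_mul x2 x1))); split.
  apply: (@realizedM p p3) => //; last exact: realizedN.
  apply: (@realizedM p p2) => //; last exact: realizedN.
  exact: (@realizedM p p1).
move=> k k4; rewrite !H5_mulE// 2!mxE e1// e2// e3// e4// i1 i1'; ring.
Qed.

Variable p : 'rV[R]_n.
Hypothesis Dp : D p.
Let x0 := iota p 0 1.
Hypothesis init : [/\ s1 x0 = 1, s2 x0 = 0 & t2 x0 = 1].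

Let Ux0 : U x0.
Proof. by have /DE[_] := Dp; rewrite /M_I /= base_x. Qed.

(** If h x0 were nonzero, s2 would vanish near x0, but s2' (x0) = 1. *)
Lemma factor_vanishes m (h : R -> R) : {for x0, continuous h} ->
  (forall x, U x -> s2 x ^+ m * h x = 0) -> h x0 = 0.
Proof.
move=> hc h0; apply: contrapT => /eqP hx0.
have [_ s20 t20] := init.
have nh : \forall x \near x0, h x != 0.
  by have := hc [set y : R | y != 0]; apply; apply: open_nbhs_nbhs; split => //; exact: open_neq.
have nU : \forall x \near x0, U x by exact: openU.
have [ds2 _] := sol2 Ux0.
have : is_derive x0 (1 : R) (fun=> 0 : R) (t2 x0).
  apply: near_eq_is_derive ds2; near=> x.
  have Ux : U x by near: x.
  have hx : h x != 0 by near: x.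
  have /eqP := h0 _ Ux; rewrite mulf_eq0 (negbTE hx) orbF expf_eq0 => /andP[_ /eqP].
  by [].
by move=> [_]; rewrite derive_cst t20 => /eqP; rewrite eq_sym oner_eq0.
Unshelve. all: by end_near. Qed.

(** A cubic form in (s1, s2) that vanishes on U is zero: at x0 only s1^3 is
    nonzero, and then powers of s2 can be factored out one after the other. *)
Lemma cubic_nondegenerate (c0 c1 c2 c3 : R) :
  (forall x, U x -> cubic 0 x * c0 + cubic 1 x * c1 + cubic 2 x * c2 + cubic 3 x * c3 = 0) ->
  [/\ c0 = 0, c1 = 0, c2 = 0 & c3 = 0].
Proof.
rewrite /cubic /= => H; have [s10 s20 t20] := init.
have cs1 : {for x0, continuous s1} by have [d _] := sol1 Ux0; exact: is_derive_continuous d.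
have cs2 : {for x0, continuous s2} by have [d _] := sol2 Ux0; exact: is_derive_continuous d.
have cc (c : R) : {for x0, continuous (fun _ : R => c)} by exact: for_continuous_cst.
have c00 : c0 = 0.
  by have := H _ Ux0; rewrite s10 s20 => <-; ring.
have c10 : c1 = 0.
  have := @factor_vanishes 1 (fun x =>
      s1 x * s1 x * c1 + s2 x * s2 x * c2 + - 3 * c3 * (s1 x * s2 x)).
  rewrite /= s10 s20 !(mulr0, mul0r, addr0, mul1r); apply.
    apply: for_continuousD; first by apply: for_continuousD; apply: for_continuousM => //;
        exact: for_continuousM.
    by apply: for_continuousM => //; exact: for_continuousM.
  by move=> x Ux; rewrite -[RHS](H _ Ux) c00; ring.
have c30 : c3 = 0.
  have : - 3 * c3 = 0.
    have := @factor_vanishes 2 (fun x => s2 x * c2 + - 3 * c3 * s1 x).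
    rewrite /= s10 s20 !(mulr0, mul0r, add0r, mulr1); apply.
      by apply: for_continuousD; exact: for_continuousM.
    by move=> x Ux; rewrite -[RHS](H _ Ux) c00 c10; ring.
  by move=> h; lra.
split => //; apply: (@factor_vanishes 3 (fun=> c2)) => // x Ux.
by rewrite -[RHS](H _ Ux) c00 c10 c30; ring.
Qed.

Let up (k : 'I_4) : 'I_5 := widen_ord (leqnSn 4) k.
Let up4 k : up k != 4.
Proof. by rewrite -val_eqE /= neq_ltn ltn_ord. Qed.

Let T (w : 'rV[R]_4) := forall b, exists x, realized p p x /\
  forall k, x 0 (up k) = b * w 0 k.

Lemma realized0 : realized p p 0.
Proof.
rewrite /realized conj_exp0//; split; rewrite ?invmx1 ?unitmx1//; exact: transport_nil.
Qed.

(** The vectors w all of whose multiples are realized modulo the centre form a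
    subspace.  It contains the integrals of the cubic monomials over all
    intervals from x0 to x; a linear form that vanishes on them vanishes on the
    derivatives with respect to x, so it is zero by
    [cubic_nondegenerate]. *)
Lemma realized_mod_center w : T w.
Proof.
apply: subspace_full.
- by move=> b; exists 0; split; [exact: realized0|move=> k; rewrite !mxE mulr0].
- move=> a v w' Tv Tw b; have [x [rx ex]] := Tv (b * a); have [y [ry ey]] := Tw b.
  exists (H5_mul y x); split; first exact: realizedM ry.
  by move=> k; rewrite H5_mulE// ex ey !mxE; ring.
move=> c cT.
have TK x : U x -> T (\row_k (K (up k) x - K (up k) x0)).
  move=> Ux b; have [|l [rl el]] := @realized_rectangle p (x - x0) (- b) Dp.
    by rewrite -/x0 addrC subrK.
  by exists l; split => // k; rewrite el// mxE opprK -/x0 (addrC x0) subrK.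
have H x : U x -> \sum_k cubic (up k) x * c k 0 = 0.
  move=> Ux.
  have : is_derive x (1 : R) (fun y => \sum_k (K (up k) y - K (up k) x0) * c k 0)
     (\sum_k cubic (up k) x * c k 0).
    apply: is_derive_sumE => k.
    rewrite -[X in is_derive _ _ _ X]addr0 -[X in _ + X](mulr0 (K (up k) x - K (up k) x0)).
    apply: (@is_derive_mulE _ _ _ (fun=> c k 0)).
    rewrite -[X in is_derive _ _ _ X]subr0.
    by have := dK (up k) Ux => ?; exact: is_deriveB.
  move=> [_ <-]; rewrite -[RHS](derive_cst (0 : R) x (1 : R)).
  apply: near_eq_derive.
  have : nbhs x U by exact: openU.
  apply: filterS => y Uy; have /matrixP/(_ 0 0) := cT _ (TK y Uy).
  rewrite mxE [RHS]mxE => e; rewrite -[RHS]e.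
  by apply: eq_bigr => k _; rewrite mxE.
have S4 (F : 'I_4 -> R) : \sum_k F k = F 0 + F 1 + F 2 + F 3.
  rewrite !big_ord_recl big_ord0 addr0 !addrA.
  by do ![congr (_ + _)|congr F; exact/val_inj].
have [c0 c1 c2 c3] : [/\ c 0 0 = 0, c 1 0 = 0, c 2 0 = 0 & c 3 0 = 0].
  by apply: cubic_nondegenerate => x /H; rewrite S4.
apply/colP => i; rewrite [RHS]mxE; case: i => [[|[|[|[|//]]]] i4].
- by rewrite -c0; congr (c _ 0); exact/val_inj.
- by rewrite -c1; congr (c _ 0); exact/val_inj.
- by rewrite -c2; congr (c _ 0); exact/val_inj.
- by rewrite -c3; congr (c _ 0); exact/val_inj.
Qed.

(** In H_5 a commutator depends only on the classes of its entries modulo the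
    centre, so it is known although the central components of its entries are
    not. *)
Lemma realized_center c : realized p p (c *: unit_vec 4).
Proof.
have [x [rx ex]] := realized_mod_center (unit_vec 0) 1.
have [y [ry ey]] := realized_mod_center (unit_vec 2) c.
have -> : c *: unit_vec 4 = H5_mul (H5_mul x y) (H5_mul (- x) (- y)).
  have xyE (k : 'I_4) (k5 : 'I_5) : up k = k5 -> x 0 k5 = unit_vec 0 0 k /\ y 0 k5 =
      c * unit_vec 2 0 k.
    by move=> <-; rewrite ex ey mul1r.
  have [x00 y00] : x 0 0 = 1 /\ y 0 0 = 0.
    by have [|-> ->] := xyE 0 0; [exact/val_inj|rewrite !mxE /= mulr0].
  have [x01 y01] : x 0 1 = 0 /\ y 0 1 = 0.
    by have [|-> ->] := xyE 1 1; [exact/val_inj|rewrite !mxE /= mulr0].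
  have [x02 y02] : x 0 2 = 0 /\ y 0 2 = c.
    by have [|-> ->] := xyE 2 2; [exact/val_inj|rewrite !mxE /= mulr1].
  have [x03 y03] : x 0 3 = 0 /\ y 0 3 = 0.
    by have [|-> ->] := xyE 3 3; [exact/val_inj|rewrite !mxE /= mulr0].
  rewrite H5_commutator /h5_bracket x00 x01 x02 x03 y00 y01 y02 y03.
  by congr (_ *: _); ring.
have rx' := realizedN Dp Dp rx; have ry' := realizedN Dp Dp ry.
by apply: (realizedM Dp); apply: (realizedM Dp).
Qed.

Lemma realized_all x : realized p p x.
Proof.
have [y [ry ey]] := realized_mod_center (\row_k x 0 (up k)) 1.
have -> : x = H5_mul ((x 0 4 - y 0 4) *: unit_vec 4) y.
  apply/rowP => k; rewrite /H5_mul /h5_bracket /unit_vec !mxE /=.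
  case: eqVneq => [->|k4] /=; first by ring.
  have [k' <-] : exists k', up k' = k.
    have k'4 : (k < 4)%N.
      by move: k4; rewrite -val_eqE /= ltn_neqAle -ltnS ltn_ord andbT.
    by exists (Ordinal k'4); exact/val_inj.
  by rewrite ey mxE; ring.
exact: (realizedM Dp ry (realized_center _)).
Qed.

Theorem holonomy_H5 : isomorphic_H5 (holonomy D A p).
Proof.
have -> : holonomy D A p = range (fun x => invmx (E p) *m H5_exp x *m E p).
  apply/seteqP; split=> B.
    by move=> /transport_conj_exp[_ [x ->]]; exists x.
  by move=> [x _ <-]; have [] := realized_all x.
by apply: isomorphic_H5_conj; exact: frame_unit.
Qed.

End Model.
End Frame.

(** * The ambient and the tractor connection *)

Section Final.
Context {R : realType}.
Variables (U : set R) (I : R -> R).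
Hypothesis openU : open U.
Hypothesis itvU : is_interval U.
Hypothesis smoothI : smooth_on U I.

(** The initial values at x0 normalize the Wronskian, which is constant because
    the equation has no first-order term. *)
Lemma solutions_exist x0 : U x0 -> exists s1 t1 s2 t2,
  [/\ solution U I s1 t1, solution U I s2 t2,
      forall x, U x -> s1 x * t2 x - t1 x * s2 x = 1 &
      [/\ s1 x0 = 1, s2 x0 = 0 & t2 x0 = 1]].
Proof.
move=> Ux0.
have Ic x : U x -> {for x, continuous I}.
  by move=> Ux; have := smoothI (k:=0%N) Ux => /derivable1_diffP; exact: differentiable_continuous.
pose c (i : bool) : R -> R := if i then cst 1 else fun x => I x / 3.
have cc i x : U x -> {for x, continuous (c i)}.
  case: i => Ux; first exact: cvg_cst.
  by apply: continuousM; [exact: Ic|exact: cvg_cst].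
have sol (a : bool -> R) : exists s t, [/\ solution U I s t, s x0 = a true & t x0 = a false].
  have [Y [Y0 dY]] := linear_system_solution a openU itvU Ux0 cc.
  exists (Y true), (Y false); split => // x Ux.
  have := dY true x Ux; have := dY false x Ux; rewrite /c /= mul1r => d1 d2; split => //.
  by rewrite mulrAC.
have [s1 [t1 [sol1 s10 t10]]] := sol (fun b => b%:R).
have [s2 [t2 [sol2 s20 t20]]] := sol (fun b => (~~ b)%:R).
exists s1, t1, s2, t2; split => // x Ux.
pose W x := s1 x * t2 x - t1 x * s2 x.
have dW y : U y -> is_derive y (1 : R) W 0.
  move=> Uy; have [? ?] := sol1 y Uy; have [? ?] := sol2 y Uy.
  have -> : 0 = (t1 y * t2 y + s1 y * (I y * s2 y / 3)) - (I y * s1 y / 3 * s2 y + t1 y * t2 y).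
    by ring.
  by apply: is_deriveB; apply: is_derive_mulE.
have [d [_ _]] := MVT_interval itvU dW Ux0 Ux.
by rewrite mul0r => /eqP; rewrite subr_eq0 => /eqP; rewrite /W s10 t10 s20 t20 => ->;
    rewrite /=; ring.
Qed.

Lemma antiderivative_cubic s1 t1 s2 t2 : solution U I s1 t1 -> solution U I s2 t2 ->
  exists K : 'I_5 -> R -> R, forall k x, U x -> is_derive x (1 : R) (K k) (cubic s1 s2 k x).
Proof.
move=> sol1 sol2; suff /choice[K KP] : forall k : 'I_5, exists F,
    forall x, U x -> is_derive x (1 : R) F (cubic s1 s2 k x) by exists K.
move=> k; apply: antiderivative => // x Ux.
have c1 : {for x, continuous s1} by have [d _] := sol1 x Ux; exact: is_derive_continuous d.
have c2 : {for x, continuous s2} by have [d _] := sol2 x Ux; exact: is_derive_continuous d.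
have cc (c : R) : {for x, continuous (fun _ : R => c)} by exact: for_continuous_cst.
move: k; apply: ord5_ind; rewrite /cubic /=.
- exact: for_continuousX.
- by apply: for_continuousM => //; exact: for_continuousX.
- exact: for_continuousX.
- by apply: for_continuousM; [exact: for_continuousM|exact: for_continuousX].
- exact: cc.
Qed.

Lemma Mt_coord_x P : Mt_I U P -> U (P 0 1).
Proof. by move=> [_]; rewrite /M_I /= base_x. Qed.

Theorem levi_civita_holonomy P : Mt_I U P ->
  isomorphic_H5 (holonomy (Mt_I U) (levi_civita (gt_I I)) P).
Proof.
move=> MP; have UP := Mt_coord_x MP.
have [s1 [t1 [s2 [t2 [sol1 sol2 wr init]]]]] := solutions_exist UP.
have [K dK] := antiderivative_cubic sol1 sol2.
by apply: (@holonomy_H5 _ U I s1 t1 s2 t2 openU itvU smoothI sol1 sol2 wr 7 (Mt_I U)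
  (levi_civita (gt_I I)) id (unit_vec 1) (unit_vec 2) _ _ _ _ K dK P).
Qed.

Lemma ray0 u : ray 1 u 0 ord0 = 1 :> R.
Proof.
rewrite /ray !mxE /= mulr1 summxE big1 ?addr0// => i _.
by rewrite !mxE /= mulr0.
Qed.

Lemma ray_mid u i : ray 1 u 0 (mid i) = u 0 i :> R.
Proof.
rewrite /ray !mxE /= mulr0 add0r summxE (bigD1 i) //= !mxE !eqxx mulr1 big1 ?addr0// => j ji.
rewrite !mxE /= (_ : (mid i == mid j) = false) ?mulr0//.
by apply/negbTE; apply: contra ji => /eqP/lift_inj/(congr1 val) /= /val_inj ->.
Qed.

Lemma ray_max u : ray 1 u 0 ord_max = 0 :> R.
Proof.
rewrite /ray !mxE /= mulr0 add0r summxE big1// => i _.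
rewrite !mxE /= (_ : (ord_max == mid i) = false) ?mulr0//.
by apply/negbTE; rewrite -val_eqE /= /bump /= add1n eqSS neq_ltn ltn_ord orbT.
Qed.

Lemma base_ray u : base (ray 1 u) = u :> 'rV[R]_5.
Proof. by apply/rowP => i; rewrite mxE ray_mid. Qed.

Lemma ord7_cases (i : 'I_7) : [\/ i = ord0, i = ord_max | exists j, i = mid j].
Proof.
have [->|i0] := eqVneq i ord0; first by constructor 1.
have [->|im] := eqVneq i ord_max; first by constructor 2.
constructor 3; case: i i0 im => [[|k] k7] // _; rewrite -val_eqE /= eqSS => k5.
have {}k5 : (k < 5)%N by rewrite ltn_neqAle k5 -ltnS -ltnS.
by exists (Ordinal k5); exact/val_inj.
Qed.

(** The frame of the tractor bundle depends on t alone, so differentiating it in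
    a direction tangent to M gives nothing, and at t = 1 it is the coordinate
    frame. *)
Lemma tractor_levi_civita (g : tensor2 R 7) u i :
  tractor_connection g u i = levi_civita g (ray 1 u) (mid i).
Proof.
apply/matrixP => j k; rewrite mxE [RHS]mxE /covariant derive_cst.
have -> : 'D_(unit_vec (mid i)) (fun P : 'rV[R]_7 => tractor_frame k (P 0 ord0)) (ray 1 u) = 0.
  rewrite /derive; under eq_fun => h.
    rewrite /= (_ : (h *: unit_vec (mid i) + ray 1 u) 0 ord0 = ray 1 u 0 ord0).
      by rewrite subrr scaler0; over.
    by rewrite !mxE /= mulr0 add0r.
  by rewrite lim_cst.
by rewrite /= ray0 tractor_frame1.
Qed.

Theorem tractor_holonomy u : M_I U u ->
  isomorphic_H5 (holonomy (M_I U) (tractor_connection (gt_I I)) u).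
Proof.
move=> Mu.
have x0E v : ray 1 v 0 1 = v 0 0 :> R by rewrite -(ray_mid v 0) midE.
have [s1 [t1 [s2 [t2 [sol1 sol2 wr init]]]]] := solutions_exist Mu.
have [K dK] := antiderivative_cubic sol1 sol2.
have MtE v : M_I U v <-> Mt_I U (ray 1 v).
  by rewrite /Mt_I /= base_ray ray0; split=> [|[]].
have rayE (f : R -> 'rV[R]_5) : [/\ (fun r => ray 1 (f r) 0 ord0) = cst 1,
    (fun r => ray 1 (f r) 0 ord_max) = cst 0 &
    forall i, (fun r => ray 1 (f r) 0 (mid i)) = fun r => f r 0 i].
  by split=> [||i]; apply/funext => r; rewrite ?ray0 ?ray_max ?ray_mid.
apply: (@holonomy_H5 _ U I s1 t1 s2 t2 openU itvU smoothI sol1 sol2 wr 5 (M_I U)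
  (tractor_connection (gt_I I)) (ray 1) (unit_vec 0) (unit_vec 1) _ _ _ _ K dK u) => //.
- move=> g C sg; rewrite !arc_transportE.
  have E s : \sum_i (fun r => g r 0 i)^`()%classic s *: tractor_connection (gt_I I) (g s) i =
     \sum_i (fun r => (ray 1 \o g) r 0 i)^`()%classic s *: levi_civita (gt_I I) ((ray 1 \o g) s) i.
    have [e0 em ei] := rayE g.
    rewrite [RHS]big_ord_recl [in RHS]big_ord_recr /= e0 derive1_cst scale0r add0r.
    rewrite (_ : lift ord0 ord_max = ord_max); last exact/val_inj.
    rewrite em derive1_cst scale0r addr0; apply: eq_bigr => i _.
    by rewrite tractor_levi_civita -ei.
  by split=> -[P [P0 P1 dP]]; exists P; split => // s s01; have := dP s s01; rewrite E.
- move=> g [sg gD]; split=> [i|s s01]; last by apply/MtE; exact: gD.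
  have [e0 em ei] := rayE g.
  case: (ord7_cases i) => [->|->|[j ->]]; rewrite /= ?e0 ?em ?ei//.
  + exact: smooth_on_cst.
  + exact: smooth_on_cst.
- move=> v a b; apply/rowP => i; case: (ord7_cases i) => [->|->|[j ->]].
  + by rewrite [RHS]mxE !ray0 !mxE /= !mulr0 !addr0.
  + by rewrite [RHS]mxE !ray_max !mxE /= !mulr0 !addr0.
  rewrite [RHS]mxE !ray_mid !mxE /=; congr (_ + (_ * _%:R + _ * _%:R)).
- by rewrite x0E.
Qed.

End Final.

Unset Implicit Arguments.

Theorem theoremA (R : realType) (U : set R) (I : R -> R)
    (openU : open U) (connectedU : connected U) (smoothI : smooth_on U I) :
  (forall u : 'rV[R]_5, M_I U u ->
     isomorphic_H5 (holonomy (M_I U) (tractor_connection (gt_I I)) u)) /\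
  (forall P : 'rV[R]_7, Mt_I U P ->
     isomorphic_H5 (holonomy (Mt_I U) (levi_civita (gt_I I)) P)).
Proof.
have itvU : is_interval U by apply/connected_intervalP.
by split=> [u|P]; [exact: tractor_holonomy|exact: levi_civita_holonomy].
Qed.
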